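(* When the number of issues $d$ is a constant, the destructive control variant of Real Value Perception Manipulation (RVPM) can be solved in polynomial time under the $l_2$ norm for arbitrary scoring rules.
   Context: Spatial election model: $n$ candidates $c_1,\dots,c_n$ and $m$ voters $v_1,\dots,v_m$ are points of $\mathbb R^d$. Each voter ranks candidates by increasing Euclidean distance; closest ranked 1; original rankings have no ties. A scoring rule is a non-increasing $f:\{1,\dots,n\}\to\mathbb R$: a candidate ranked $t$ by a voter receives $f(t)$; totals summed; highest total wins. Given $\epsilon>0$, an adversary may replace target $c_1$ by any $\tilde c_1\in\mathbb R^d$ with $\|\tilde c_1-c_1\|_2\le\epsilon$; ties created by the manipulation are broken in the adversary's favor. Destructive control: decide whether some such $\tilde c_1$ makes $c_1$ lose (with $c_1$ placed behind equidistant candidates, some other candidate's total is at least $c_1$'s total). *)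

(* Defs.v *)
From Stdlib Require Import Reals List Arith Bool.
Open Scope bool_scope.
Open Scope R_scope.

(* Geometry: points of R^d are functions nat -> R, only coordinates    *)
(* 0..d-1 matter.                                                      *)
Fixpoint sumR (d : nat) (g : nat -> R) : R :=
  match d with O => 0 | S d' => sumR d' g + g d' end.

Definition dist (d : nat) (x y : nat -> R) : R :=
  sqrt (sumR d (fun t => (x t - y t) ^ 2)).

Fixpoint countN (n : nat) (P : nat -> bool) : nat :=
  match n with O => O | S n' => (countN n' P + if P n' then 1 else 0)%nat end.

Definition Rltb (a b : R) : bool := if Rlt_dec a b then true else false.
Definition Rleb (a b : R) : bool := if Rle_dec a b then true else false.

(* Election after the target c_1 (index 0) is moved to x.  Candidates are
   c 0, ..., c (n-1) (c 0 = target c_1), voters v 0, ..., v (m-1).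
   Ranks start at 1.  Ties created by the manipulation (only possible
   between x and some other candidate) are broken against the target:
   the target is placed behind every candidate equidistant to the voter. *)
Definition rank_target (d n : nat) (c : nat -> nat -> R) (x vk : nat -> R) : nat :=
  S (countN n (fun j => negb (Nat.eqb j 0) && Rleb (dist d vk (c j)) (dist d vk x))).

Definition rank_other (d n : nat) (c : nat -> nat -> R) (x vk : nat -> R) (j : nat) : nat :=
  S (countN n (fun l => negb (Nat.eqb l 0) && negb (Nat.eqb l j)
                        && Rltb (dist d vk (c l)) (dist d vk (c j)))
     + (if Rltb (dist d vk x) (dist d vk (c j)) then 1 else 0)).

Fixpoint sumV (m : nat) (g : nat -> R) : R :=
  match m with O => 0 | S m' => sumV m' g + g m' end.

Definition score_target d n m c v (f : nat -> R) x : R :=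
  sumV m (fun k => f (rank_target d n c x (v k))).

Definition score_other d n m c v (f : nat -> R) x j : R :=
  sumV m (fun k => f (rank_other d n c x (v k) j)).

Definition valid_instance (d n m : nat) (c v : nat -> nat -> R) (f : nat -> R) (eps : R) : Prop :=
  (1 <= n)%nat /\ 0 < eps /\
  (forall a b, (1 <= a)%nat -> (a <= b)%nat -> (b <= n)%nat -> f b <= f a) /\
  (forall k i j, (k < m)%nat -> (i < n)%nat -> (j < n)%nat -> i <> j ->
     dist d (v k) (c i) <> dist d (v k) (c j)).

Definition destructive_yes (d n m : nat) (c v : nat -> nat -> R) (f : nat -> R) (eps : R) : Prop :=
  exists x : nat -> R, dist d x (c O) <= eps /\
    exists j, (1 <= j < n)%nat /\ score_other d n m c v f x j >= score_target d n m c v f x.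

(* Computation model: a real RAM (unit-cost arithmetic +,-,*,/, sqrt on *)
(* reals, comparisons, integer registers with + and truncated -,        *)
(* indirect addressing).                                                *)
Inductive instr : Type :=
| NSet  (i k : nat)
| NAdd  (i j k : nat)
| NSub  (i j k : nat)
| NLoad (i j : nat)
| NStore (i j : nat)
| NJz   (i t : nat)
| RSet  (i k : nat)
| RAdd  (i j k : nat)
| RSub  (i j k : nat)
| RMul  (i j k : nat)
| RDiv  (i j k : nat)
| RSqrt (i j : nat)
| RLoad (i j : nat)
| RStore (i j : nat)
| RJle  (i j t : nat)
| Jmp   (t : nat).

Definition program := list instr.

Record config := Config { pc : nat; nreg : nat -> nat; rreg : nat -> R }.

Definition upd {A : Type} (g : nat -> A) (i : nat) (a : A) : nat -> A :=
  fun j => if Nat.eqb j i then a else g j.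

Definition step (ins : instr) (s : config) : config :=
  let p := S (pc s) in let N := nreg s in let Rr := rreg s in
  match ins with
  | NSet i k => Config p (upd N i k) Rr
  | NAdd i j k => Config p (upd N i (N j + N k)%nat) Rr
  | NSub i j k => Config p (upd N i (N j - N k)%nat) Rr
  | NLoad i j => Config p (upd N i (N (N j))) Rr
  | NStore i j => Config p (upd N (N i) (N j)) Rr
  | NJz i t => Config (if Nat.eqb (N i) 0 then t else p) N Rr
  | RSet i k => Config p N (upd Rr i (INR k))
  | RAdd i j k => Config p N (upd Rr i (Rr j + Rr k))
  | RSub i j k => Config p N (upd Rr i (Rr j - Rr k))
  | RMul i j k => Config p N (upd Rr i (Rr j * Rr k))
  | RDiv i j k => Config p N (upd Rr i (Rr j / Rr k))
  | RSqrt i j => Config p N (upd Rr i (sqrt (Rr j)))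
  | RLoad i j => Config p N (upd Rr i (Rr (N j)))
  | RStore i j => Config p N (upd Rr (N i) (Rr j))
  | RJle i j t => Config (if Rleb (Rr i) (Rr j) then t else p) N Rr
  | Jmp t => Config t N Rr
  end.

(* The machine halts when pc points outside the program.  [exec P t s]
   is [Some s'] iff the machine halts within t steps, in configuration s'. *)
Fixpoint exec (P : program) (fuel : nat) (s : config) : option config :=
  match nth_error P (pc s) with
  | None => Some s
  | Some ins => match fuel with
                | O => None
                | S fuel' => exec P fuel' (step ins s)
                end
  end.

(* Input encoding: N[0] = n, N[1] = m; R[0] = eps, R[a] = f a (1<=a<=n),
   R[1+n+i*d+t] = t-th coordinate of candidate i (i<n, t<d),
   R[1+n+n*d+k*d+t] = t-th coordinate of voter k (k<m, t<d);
   all other registers are 0. *)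
Definition init_config (d n m : nat) (c v : nat -> nat -> R) (f : nat -> R) (eps : R)
  : config :=
  Config O
    (fun r => if Nat.eqb r 0 then n else if Nat.eqb r 1 then m else O)
    (fun r =>
       if Nat.eqb r 0 then eps
       else if Nat.leb r n then f r
       else if Nat.ltb r (1 + n + n * d) then
         c ((r - 1 - n) / d)%nat ((r - 1 - n) mod d)%nat
       else if Nat.ltb r (1 + n + n * d + m * d) then
         v ((r - 1 - n - n * d) / d)%nat ((r - 1 - n - n * d) mod d)%nat
       else 0).

(* Number of input numbers. *)
Definition input_size (d n m : nat) : nat := (3 + n + n * d + m * d)%nat.

(* Main.v *)
From Stdlib Require Import Reals List Arith Bool Lra Lia Psatz FunctionalExtensionality Classical.
Require Import Defs.
Open Scope R_scope.

(** Since the scoring rule is non-increasing, it never helps the target to be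
    farther from a voter.  Hence a winning position [x] may be replaced by any
    point that satisfies the closed sign conditions of [x] with respect to the
    spheres around the voters through the candidates, and to the ball of
    allowed moves.  Move [x] until it touches a sphere, and then along the
    intersection of the touched spheres, which is a sphere in an affine
    subspace of smaller dimension.  Unless a new sphere in general position is
    touched on the way (which happens at most [d] times), a prescribed point of it
    is reached: the centre of the intersection plus or minus its radius times
    the normalized projection of a standard basis vector.  So it suffices to test, for
    all tuples of at most [d + 1] spheres, the [2 d + 1] points obtained by
    Gram-Schmidt from the radical hyperplanes of the tuple.

    The resulting count of successful tests is built from the input by
    arithmetic, square roots, comparisons and sums over voters and candidates.
    The functions computed by polynomial-time relocatable fragments of
    real-RAM code are closed under these operations. *)

(** Ties count against the target, so a winning position stays winning when a move puts it exactly
    on a sphere through a candidate; this makes the closed conditions the right ones.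

    The ball of allowed moves is a constraint like the others, so a long enough straight path must
    cross some sphere: a first touch always exists when [d] is positive. On an intersection of
    spheres the squared distance to any fixed point is an affine function. Hence a further sphere
    either meets no change along the intersection or cuts it by a hyperplane, and only spheres of
    the second kind lower the dimension. That dimension is measured by the trace of a projection, a
    number that starts at [d] and loses one with each new normal, so no theory of subspaces is
    required.

    Degenerate tuples lead to divisions by zero. They are harmless: every point produced is tested
    against the exact winning condition, so general position matters for completeness only. *)

(** * Finite sums and the inner product on R^d *)

Lemma sumR_ext (d : nat) (g h : nat -> R) :
  (forall t, (t < d)%nat -> g t = h t) -> sumR d g = sumR d h.
Proof.
  induction d as [|d IH]; simpl; intros H; [reflexivity|].
  rewrite IH, H; auto.
Qed.

Lemma sumR_lin (d : nat) (al be : R) (g h : nat -> R) :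
  sumR d (fun t => al * g t + be * h t) = al * sumR d g + be * sumR d h.
Proof. induction d as [|d IH]; simpl; [|rewrite IH]; ring. Qed.

Lemma sumR_ge0 (d : nat) (g : nat -> R) :
  (forall t, (t < d)%nat -> 0 <= g t) -> 0 <= sumR d g.
Proof.
  induction d as [|d IH]; simpl; intros H; [lra|].
  assert (0 <= sumR d g) by auto. assert (0 <= g d) by auto. lra.
Qed.

Lemma sumR_ge_term (d : nat) (g : nat -> R) (i : nat) :
  (forall t, (t < d)%nat -> 0 <= g t) -> (i < d)%nat -> g i <= sumR d g.
Proof.
  induction d as [|d IH]; simpl; intros H Hi; [lia|].
  assert (0 <= g d) by auto.
  destruct (Nat.eq_dec i d) as [->|Hne].
  - assert (0 <= sumR d g) by (apply sumR_ge0; auto). lra.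
  - assert (g i <= sumR d g) by (apply IH; auto; lia). lra.
Qed.

Definition dot (d : nat) (x y : nat -> R) : R := sumR d (fun t => x t * y t).

Definition sqd (d : nat) (x y : nat -> R) : R := sumR d (fun t => (x t - y t) ^ 2).

Definition basis (i : nat) : nat -> R := fun t => if Nat.eqb t i then 1 else 0.

Lemma dot_sym (d : nat) (x y : nat -> R) : dot d x y = dot d y x.
Proof. apply sumR_ext; intros; ring. Qed.

Lemma dot_lin_l (d : nat) (al be : R) (x y z : nat -> R) :
  dot d (fun t => al * x t + be * y t) z = al * dot d x z + be * dot d y z.
Proof.
  unfold dot. rewrite <- sumR_lin. apply sumR_ext; intros; ring.
Qed.

Lemma dot_lin_r (d : nat) (al be : R) (x y z : nat -> R) :
  dot d z (fun t => al * x t + be * y t) = al * dot d z x + be * dot d z y.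
Proof. rewrite dot_sym, dot_lin_l, !(dot_sym d z). reflexivity. Qed.

Lemma dot_scal_l (d : nat) (al : R) (x z : nat -> R) :
  dot d (fun t => al * x t) z = al * dot d x z.
Proof.
  replace (fun t => al * x t) with (fun t => al * x t + 0 * x t)
    by (apply functional_extensionality; intro; ring).
  rewrite dot_lin_l. ring.
Qed.

Lemma dot_scal_r (d : nat) (al : R) (x z : nat -> R) :
  dot d z (fun t => al * x t) = al * dot d z x.
Proof. rewrite dot_sym, dot_scal_l, dot_sym. reflexivity. Qed.

Lemma dot_sub_l (d : nat) (x y z : nat -> R) :
  dot d (fun t => x t - y t) z = dot d x z - dot d y z.
Proof.
  replace (fun t => x t - y t) with (fun t => 1 * x t + (-1) * y t)
    by (apply functional_extensionality; intro; ring).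
  rewrite dot_lin_l. ring.
Qed.

Lemma dot_sub_r (d : nat) (x y z : nat -> R) :
  dot d z (fun t => x t - y t) = dot d z x - dot d z y.
Proof. rewrite dot_sym, dot_sub_l, !(dot_sym d z). reflexivity. Qed.

Lemma dot_add_l (d : nat) (x y z : nat -> R) :
  dot d (fun t => x t + y t) z = dot d x z + dot d y z.
Proof.
  replace (fun t => x t + y t) with (fun t => 1 * x t + 1 * y t)
    by (apply functional_extensionality; intro; ring).
  rewrite dot_lin_l. ring.
Qed.

Lemma dot_add_r (d : nat) (x y z : nat -> R) :
  dot d z (fun t => x t + y t) = dot d z x + dot d z y.
Proof. rewrite dot_sym, dot_add_l, !(dot_sym d z). reflexivity. Qed.

Lemma dot_self_ge0 (d : nat) (x : nat -> R) : 0 <= dot d x x.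
Proof. apply sumR_ge0; intros; nra. Qed.

Lemma dot_self_eq0 (d : nat) (x : nat -> R) (t : nat) :
  dot d x x = 0 -> (t < d)%nat -> x t = 0.
Proof.
  intros H Ht.
  assert (x t * x t <= dot d x x)
    by (apply (sumR_ge_term d (fun t => x t * x t)); auto; intros; nra).
  nra.
Qed.

Lemma dot_null_l (d : nat) (x y : nat -> R) : dot d x x = 0 -> dot d x y = 0.
Proof.
  intros H. unfold dot. rewrite (sumR_ext d _ (fun t => 0 * x t + 0 * x t)).
  - rewrite sumR_lin. ring.
  - intros t Ht. rewrite (dot_self_eq0 d x t H Ht). ring.
Qed.

Lemma dot_basis (d : nat) (x : nat -> R) (i : nat) :
  (i < d)%nat -> dot d (basis i) x = x i.
Proof.
  unfold dot, basis. induction d as [|d IH]; intros Hi; [lia|]. simpl.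
  destruct (Nat.eqb_spec d i) as [->|Hne].
  - rewrite (sumR_ext i _ (fun t => 0 * x t + 0 * x t)).
    + rewrite sumR_lin. ring.
    + intros t Ht. destruct (Nat.eqb_spec t i); [lia|ring].
  - rewrite IH by lia. ring.
Qed.

Lemma sqd_dot (d : nat) (x y : nat -> R) :
  sqd d x y = dot d (fun t => x t - y t) (fun t => x t - y t).
Proof. apply sumR_ext; intros; ring. Qed.

Lemma sqd_ext (d : nat) (x y a : nat -> R) :
  (forall t, (t < d)%nat -> x t = y t) -> sqd d x a = sqd d y a.
Proof. intros H. apply sumR_ext; intros t Ht. rewrite H; auto. Qed.

(** * Residual operators *)

(* [residual d us] is the orthogonal projection onto the complement of the
   span of [us] as soon as [orthobasis d us] holds. *)
Fixpoint residual (d : nat) (us : list (nat -> R)) (b : nat -> R) : nat -> R :=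
  match us with
  | nil => b
  | u :: us' => fun t => residual d us' b t - dot d b u * u t
  end.

(** Orthogonality of [u] to the earlier vectors is stated as being fixed by their residual operator,
    the form in which idempotence uses it. *)
Fixpoint orthobasis (d : nat) (us : list (nat -> R)) : Prop :=
  match us with
  | nil => True
  | u :: us' => orthobasis d us' /\ residual d us' u = u /\ dot d u u = 1
  end.

Lemma residual_lin (d : nat) (us : list (nat -> R)) (al be : R) (x y : nat -> R) :
  residual d us (fun t => al * x t + be * y t) =
  (fun t => al * residual d us x t + be * residual d us y t).
Proof.
  induction us as [|u us IH]; simpl; [reflexivity|].
  apply functional_extensionality; intro t.
  rewrite IH, dot_lin_l. ring.
Qed.

Lemma residual_scal (d : nat) (us : list (nat -> R)) (al : R) (x : nat -> R) :
  residual d us (fun t => al * x t) = (fun t => al * residual d us x t).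
Proof.
  replace (fun t => al * x t) with (fun t => al * x t + 0 * x t)
    by (apply functional_extensionality; intro; ring).
  rewrite residual_lin. apply functional_extensionality; intro; ring.
Qed.

Lemma residual_self_adjoint (d : nat) (us : list (nat -> R)) (x y : nat -> R) :
  dot d (residual d us x) y = dot d x (residual d us y).
Proof.
  induction us as [|u us IH]; simpl; [reflexivity|].
  rewrite dot_sub_l, dot_sub_r, dot_scal_l, dot_scal_r, IH, (dot_sym d u y). ring.
Qed.

Lemma residual_idempotent (d : nat) (us : list (nat -> R)) (b : nat -> R) :
  orthobasis d us -> residual d us (residual d us b) = residual d us b.
Proof.
  induction us as [|u us IH]; simpl; [reflexivity|].
  intros (H1 & H2 & H3). specialize (IH H1).
  replace (fun t => residual d us b t - dot d b u * u t)
    with (fun t => 1 * residual d us b t + (- dot d b u) * u t)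
    by (apply functional_extensionality; intro; ring).
  rewrite residual_lin, IH, H2, dot_lin_l, residual_self_adjoint, H2, H3.
  apply functional_extensionality; intro; ring.
Qed.

(** For orthonormal [us] this is the rank of the projection, that is, the dimension still available
    to the search. *)
Definition trace (d : nat) (us : list (nat -> R)) : R :=
  sumR d (fun i => residual d us (basis i) i).

Lemma trace_nil (d : nat) : trace d nil = INR d.
Proof.
  unfold trace; simpl.
  rewrite (sumR_ext d _ (fun _ => 1)).
  - induction d as [|d IH]; [reflexivity|]. rewrite S_INR; simpl sumR. rewrite IH. reflexivity.
  - intros t _. unfold basis. now rewrite Nat.eqb_refl.
Qed.

Lemma trace_cons (d : nat) (u : nat -> R) (us : list (nat -> R)) :
  trace d (u :: us) = trace d us - dot d u u.
Proof.
  change (dot d u u) with (sumR d (fun t => u t * u t)). unfold trace; simpl.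
  replace (sumR d (fun i => residual d us (basis i) i) - sumR d (fun t => u t * u t))
    with (1 * sumR d (fun i => residual d us (basis i) i) + (-1) * sumR d (fun t => u t * u t))
    by ring.
  rewrite <- sumR_lin. apply sumR_ext; intros t Ht. rewrite dot_basis by auto. ring.
Qed.

(** A symmetric idempotent P satisfies |P e|^2 = <e, P e>. The diagonal entries are therefore
    nonnegative and each is bounded by the trace. *)
Lemma residual_basis_diag (d : nat) (us : list (nat -> R)) (i : nat) :
  orthobasis d us -> (i < d)%nat ->
  dot d (residual d us (basis i)) (residual d us (basis i)) = residual d us (basis i) i.
Proof.
  intros Hg Hi.
  rewrite residual_self_adjoint, residual_idempotent by auto.
  now apply dot_basis.
Qed.

Lemma residual_basis_le_trace (d : nat) (us : list (nat -> R)) (i : nat) :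
  orthobasis d us -> (i < d)%nat ->
  dot d (residual d us (basis i)) (residual d us (basis i)) <= trace d us.
Proof.
  intros Hg Hi. rewrite residual_basis_diag by auto.
  apply (sumR_ge_term d (fun i => residual d us (basis i) i)); auto.
  intros t Ht. rewrite <- residual_basis_diag by auto. apply dot_self_ge0.
Qed.

(** By self-adjointness, coordinate t of [residual d us x] is the inner product of [x] with the
    residual of the t-th basis vector. *)
Lemma residual_null (d : nat) (us : list (nat -> R)) (x : nat -> R) :
  (forall i, (i < d)%nat ->
     dot d (residual d us (basis i)) (residual d us (basis i)) = 0) ->
  dot d (residual d us x) (residual d us x) = 0.
Proof.
  intros H. unfold dot. rewrite (sumR_ext d _ (fun t => 0 * x t + 0 * x t)).
  - rewrite sumR_lin. ring.
  - intros t Ht.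
    rewrite <- (dot_basis d (residual d us x) t Ht), <- residual_self_adjoint, dot_null_l
      by auto.
    ring.
Qed.

(** Normalization is meaningful only for a nonzero residual. The search also evaluates it in
    degenerate cases, where it merely yields one more point to test. *)
Definition unit_dir (d : nat) (us : list (nat -> R)) (b : nat -> R) : nat -> R :=
  fun t => residual d us b t / sqrt (dot d (residual d us b) (residual d us b)).

Lemma unit_dir_scal (d : nat) (us : list (nat -> R)) (b : nat -> R) :
  unit_dir d us b =
  (fun t => / sqrt (dot d (residual d us b) (residual d us b)) * residual d us b t).
Proof. apply functional_extensionality; intro; unfold unit_dir, Rdiv; ring. Qed.

Lemma residual_unit_dir (d : nat) (us : list (nat -> R)) (b : nat -> R) :
  orthobasis d us -> residual d us (unit_dir d us b) = unit_dir d us b.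
Proof. intros H. rewrite unit_dir_scal, residual_scal, residual_idempotent; auto. Qed.

Lemma unit_dir_norm (d : nat) (us : list (nat -> R)) (b : nat -> R) :
  dot d (residual d us b) (residual d us b) <> 0 ->
  dot d (unit_dir d us b) (unit_dir d us b) = 1.
Proof.
  intros H. rewrite unit_dir_scal, dot_scal_l, dot_scal_r.
  set (N := dot d (residual d us b) (residual d us b)) in *.
  assert (0 < N) by (assert (0 <= N) by apply dot_self_ge0; lra).
  assert (0 < sqrt N) by (apply sqrt_lt_R0; auto).
  rewrite <- (sqrt_sqrt N) at 3 by lra. field. lra.
Qed.

(** * Intersections of spheres *)

(* The state describes the intersection of the sphere around [ctr] of squared
   radius [rad2] with an affine subspace: [dirs] are orthonormal normals of the
   subspace and [ctr + off] is the projection of [ctr] onto it. *)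
Record state := St { ctr : nat -> R; rad2 : R; off : nat -> R; dirs : list (nat -> R) }.

Definition start (a : nat -> R) (r : R) : state := St a r (fun _ => 0) nil.

(* Intersecting with the sphere around [a] of squared radius [r] amounts to
   intersecting with the radical hyperplane of the two spheres. *)
Definition extend (d : nat) (st : state) (a : nat -> R) (r : R) : state :=
  let b := fun t => a t - ctr st t in
  let N := dot d (residual d (dirs st) b) (residual d (dirs st) b) in
  let s := ((rad2 st - r + dot d b b) / 2 - dot d b (off st)) / sqrt N in
  St (ctr st) (rad2 st)
     (fun t => off st t + s * unit_dir d (dirs st) b t)
     (unit_dir d (dirs st) b :: dirs st).

Definition radius (d : nat) (st : state) : R := sqrt (rad2 st - dot d (off st) (off st)).

Definition cand (d : nat) (st : state) (h : R) (i : nat) : nat -> R :=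
  fun t => ctr st t + off st t + h * unit_dir d (dirs st) (basis i) t.

(* [x] lies on the intersection described by [st]. *)
Definition located (d : nat) (st : state) (x : nat -> R) : Prop :=
  let q := fun t => x t - ctr st t in
  orthobasis d (dirs st) /\ dot d q q = rad2 st /\
  off st = (fun t => q t - residual d (dirs st) q t).

Lemma located_start (d : nat) (a x : nat -> R) (r : R) :
  sqd d x a = r -> located d (start a r) x.
Proof.
  intros H. unfold located, start; simpl. repeat split.
  - now rewrite <- sqd_dot.
  - apply functional_extensionality; intro; ring.
Qed.

Definition offset (st : state) (y : nat -> R) : nat -> R := fun t => ctr st t + off st t + y t.

(** Pythagoras: [off] is orthogonal to [y], and |y| = |z| keeps the point at squared distance [rad2]
    from [ctr]. The quadratic term is thus constant, and the squared distance to any [a] becomes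
    affine in [y]. *)
Lemma sqd_offset (d : nat) (st : state) (x y a : nat -> R) :
  let z := residual d (dirs st) (fun t => x t - ctr st t) in
  let b := fun t => a t - ctr st t in
  located d st x -> residual d (dirs st) y = y -> dot d y y = dot d z z ->
  sqd d (offset st y) a = rad2 st + dot d b b - 2 * dot d b (off st) - 2 * dot d b y.
Proof.
  intros z b (Hg & Hr & Ho) Hy Hn.
  set (q := fun t => x t - ctr st t) in *.
  change (off st = fun t => q t - residual d (dirs st) q t) in Ho. clearbody q.
  assert (E1 : dot d (off st) y = 0).
  { rewrite Ho, dot_sub_l, residual_self_adjoint, Hy. ring. }
  assert (E2 : dot d (off st) (off st) + dot d z z = rad2 st).
  { rewrite <- Hr, Ho. fold z. rewrite !dot_sub_l, !dot_sub_r.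
    assert (dot d z z = dot d q z).
    { unfold z at 1. rewrite residual_self_adjoint. unfold z.
      now rewrite residual_idempotent. }
    rewrite (dot_sym d z q). lra. }
  rewrite sqd_dot.
  replace (fun t => offset st y t - a t) with (fun t => (off st t + y t) - b t)
    by (apply functional_extensionality; intro; unfold offset, b; ring).
  rewrite !dot_sub_l, !dot_sub_r, !dot_add_l, !dot_add_r, Hn,
    (dot_sym d y (off st)), E1, (dot_sym d (off st) b), (dot_sym d y b).
  lra.
Qed.

Lemma offset_residual (d : nat) (st : state) (x : nat -> R) :
  located d st x ->
  offset st (residual d (dirs st) (fun t => x t - ctr st t)) = x.
Proof.
  intros (_ & _ & Ho). unfold offset. rewrite Ho.
  apply functional_extensionality; intro; simpl; ring.
Qed.

(** Taking [ctr st] itself as the centre in [sqd_offset] gives the radius condition; [off] is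
    unchanged because its own residual is zero. *)
Lemma located_offset (d : nat) (st : state) (x y : nat -> R) :
  let z := residual d (dirs st) (fun t => x t - ctr st t) in
  located d st x -> residual d (dirs st) y = y -> dot d y y = dot d z z ->
  located d st (offset st y).
Proof.
  intros z Hl Hy Hn. pose proof Hl as (Hg & Hr & Ho).
  repeat split; auto.
  - rewrite <- sqd_dot, (sqd_offset d st x y (ctr st)) by auto.
    assert (N : forall w, dot d (fun t => ctr st t - ctr st t) w = 0)
      by (intro; rewrite dot_sub_l; ring).
    rewrite !N. ring.
  - replace (fun t => offset st y t - ctr st t) with (fun t => 1 * off st t + 1 * y t)
      by (apply functional_extensionality; intro; unfold offset; ring).
    rewrite residual_lin, Hy.
    assert (E : residual d (dirs st) (off st) = fun _ => 0).
    { rewrite Ho. fold z.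
      replace (fun t => x t - ctr st t - z t)
        with (fun t => 1 * (x t - ctr st t) + (-1) * z t)
        by (apply functional_extensionality; intro; ring).
      assert (Ez : residual d (dirs st) z = z) by (unfold z; now rewrite residual_idempotent).
      rewrite residual_lin, Ez. fold z. apply functional_extensionality; intro; ring. }
    rewrite E. apply functional_extensionality; intro; unfold offset; ring.
Qed.

(** Write c = a - ctr. From |q|^2 = rad2 and |q - c|^2 = r one gets <c, q> = (rad2 - r + <c, c>) /
    2. Subtracting <c, off> leaves <residual c, q>, because off = q - residual q. Division by the
    norm of residual c gives the coordinate of q along the new unit normal, which is the coefficient
    [s] in [extend]. *)
Lemma located_extend (d : nat) (st : state) (x a : nat -> R) (r : R) :
  let b := residual d (dirs st) (fun t => a t - ctr st t) in
  located d st x -> sqd d x a = r -> dot d b b <> 0 ->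
  located d (extend d st a r) x.
Proof.
  intros b (Hg & Hr & Ho) Ha Hb.
  set (q := fun t => x t - ctr st t) in *.
  change (off st = fun t => q t - residual d (dirs st) q t) in Ho.
  unfold extend, located; simpl. fold q.
  split; [split; [auto|split]|split].
  - now apply residual_unit_dir.
  - now apply unit_dir_norm.
  - auto.
  - apply functional_extensionality; intro t. fold b.
    set (u := unit_dir d (dirs st) (fun t => a t - ctr st t)) in *.
    enough (E : ((rad2 st - r + dot d (fun t => a t - ctr st t) (fun t => a t - ctr st t)) / 2
             - dot d (fun t => a t - ctr st t) (off st)) / sqrt (dot d b b) = dot d q u).
    { rewrite E, Ho. unfold q at 1. ring. }
    unfold u. rewrite unit_dir_scal. fold b.
    rewrite dot_scal_r. unfold b at 5. rewrite <- residual_self_adjoint.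
    set (c := fun t => a t - ctr st t) in *.
    assert (E1 : dot d c (off st) = dot d c q - dot d (residual d (dirs st) q) c).
    { rewrite Ho, dot_sub_r. f_equal. apply dot_sym. }
    assert (E2 : r = rad2 st - 2 * dot d c q + dot d c c).
    { rewrite <- Ha, <- Hr, sqd_dot.
      replace (fun t => x t - a t) with (fun t => q t - c t)
        by (apply functional_extensionality; intro; unfold q, c; ring).
      rewrite !dot_sub_l, !dot_sub_r, (dot_sym d q c). ring. }
    rewrite E1. rewrite E2 at 1. unfold Rdiv. field.
    apply Rgt_not_eq, sqrt_lt_R0.
    assert (0 <= dot d b b) by apply dot_self_ge0. lra.
Qed.

Lemma trace_extend (d : nat) (st : state) (a : nat -> R) (r : R) :
  let b := residual d (dirs st) (fun t => a t - ctr st t) in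
  dot d b b <> 0 -> trace d (dirs (extend d st a r)) = trace d (dirs st) - 1.
Proof.
  intros b Hb. simpl. rewrite trace_cons, unit_dir_norm; auto.
Qed.

(** * First exit along a path *)

Lemma continuity_Rmin (f g : R -> R) :
  continuity f -> continuity g -> continuity (fun x => Rmin (f x) (g x)).
Proof.
  intros Hf Hg.
  assert (E : (fun x => Rmin (f x) (g x)) =
              (mult_real_fct (/ 2) (minus_fct (plus_fct f g) (comp Rabs (minus_fct f g))))).
  { apply functional_extensionality; intro x.
    unfold mult_real_fct, minus_fct, plus_fct, comp, Rmin, Rabs.
    destruct (Rle_dec (f x) (g x)); destruct (Rcase_abs (f x - g x)); lra. }
  rewrite E. apply continuity_scal, continuity_minus.
  - now apply continuity_plus.
  - apply continuity_comp; [now apply continuity_minus|apply Rcontinuity_abs].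
Qed.

Lemma list_min_continuous (A : Type) (G : A -> R -> R) (l : list A) :
  (forall a, In a l -> continuity (G a)) -> l <> nil ->
  exists M : R -> R, continuity M /\
    (forall x a, In a l -> M x <= G a x) /\ (forall x, exists a, In a l /\ M x = G a x).
Proof.
  induction l as [|a l IH]; intros Hc Hne; [congruence|].
  destruct l as [|b l].
  - exists (G a). split; [apply Hc; left; auto|]. split.
    + intros x c [->|[]]; lra.
    + intros x; exists a; split; [left|]; auto.
  - destruct IH as (M & HM & Hle & Hex); [intros c Hin; apply Hc; right; auto|discriminate|].
    exists (fun x => Rmin (G a x) (M x)). split; [|split].
    + apply continuity_Rmin; auto. apply Hc; left; auto.
    + intros x c [->|Hin]; [apply Rmin_l|].
      eapply Rle_trans; [apply Rmin_r|auto].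
    + intros x. unfold Rmin. destruct (Rle_dec (G a x) (M x)).
      * exists a; split; [left|]; auto.
      * destruct (Hex x) as (c & Hin & E). exists c; split; [right|]; auto.
Qed.

(** The intermediate value theorem is applied to the minimum of the finitely many functions: at a
    zero of the minimum all of them are nonnegative and one vanishes. The parameter need not be the
    first one with this property. *)
Lemma first_exit (A : Type) (G : A -> R -> R) (l : list A) :
  (forall a, In a l -> continuity (G a)) ->
  (forall a, In a l -> 0 <= G a 0) ->
  (exists a, In a l /\ G a 1 < 0) ->
  exists x, 0 <= x <= 1 /\ (forall a, In a l -> 0 <= G a x) /\
    exists a, In a l /\ G a x = 0.
Proof.
  intros Hc H0 (a1 & Hin1 & H1).
  destruct (list_min_continuous A G l Hc) as (M & HM & Hle & Hex).
  { intros ->. destruct Hin1. }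
  destruct (IVT_cor M 0 1 HM) as (x & Hx & E).
  - lra.
  - destruct (Hex 0) as (a0 & Hin0 & E0). pose proof (H0 a0 Hin0).
    pose proof (Hle 1 a1 Hin1). nra.
  - exists x. split; [auto|]. split.
    + intros a Ha. rewrite <- E. auto.
    + destruct (Hex x) as (a & Ha & Ea). exists a; split; auto. lra.
Qed.

Definition affine_fct (a b x : R) : R := a + b * x.

Lemma continuity_affine (a b : R) : continuity (affine_fct a b).
Proof.
  apply (continuity_plus (fct_cte a) (mult_real_fct b id)).
  - apply continuity_const. intros x y; reflexivity.
  - apply continuity_scal. apply derivable_continuous, derivable_id.
Qed.

Lemma continuity_quadratic (a b c : R) : continuity (fun x => a + b * x + c * (x * x)).
Proof.
  assert (E : (fun x => a + b * x + c * (x * x)) =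
              plus_fct (affine_fct a b) (mult_real_fct c (mult_fct id id))).
  { apply functional_extensionality; intro; reflexivity. }
  rewrite E. apply continuity_plus; [apply continuity_affine|].
  apply continuity_scal, continuity_mult; apply derivable_continuous, derivable_id.
Qed.

Lemma continuity_sqrt_quadratic (a b c : R) :
  (forall x, 0 <= a + b * x + c * (x * x)) ->
  continuity (fun x => sqrt (a + b * x + c * (x * x))).
Proof.
  intros H x.
  apply (continuity_pt_comp (fun x => a + b * x + c * (x * x)) sqrt).
  - apply continuity_quadratic.
  - apply continuity_pt_sqrt, H.
Qed.

(** * Moving a feasible point to a candidate *)

(* A constraint [(a, r, s)] asks for [|x - a|^2 >= r] if [s > 0] and for
   [|x - a|^2 <= r] if [s < 0]. *)
Definition feasible (d : nat) (cs : list ((nat -> R) * R * R)) (x : nat -> R) : Prop :=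
  forall a r s, In (a, r, s) cs -> 0 <= s * (sqd d x a - r).

(** Move from [x] along an arc of the intersection to the candidate on the side of [x]. Constraints
    with constant distance on the arc remain satisfied. So if the candidate is infeasible, a
    constraint that does vary fails at the end of the arc, and some varying constraint is tight at a
    feasible point on the way. *)
Lemma arc_step (d : nat) (cs : list ((nat -> R) * R * R)) (st : state) (x : nat -> R) (i : nat) :
  let y := residual d (dirs st) (fun t => x t - ctr st t) in
  let e := residual d (dirs st) (basis i) in
  (forall a r s, In (a, r, s) cs -> s <> 0) ->
  located d st x -> feasible d cs x -> dot d y y <> 0 -> dot d e e <> 0 ->
  feasible d cs (cand d st (radius d st) i) \/
  feasible d cs (cand d st (- radius d st) i) \/
  exists x' a r s, In (a, r, s) cs /\ located d st x' /\ feasible d cs x' /\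
    sqd d x' a = r /\
    let b := residual d (dirs st) (fun t => a t - ctr st t) in dot d b b <> 0.
Proof.
  intros y e Hs Hl Hf Hy He.
  pose proof Hl as (Hg & Hr & Ho).
  set (w := unit_dir d (dirs st) (basis i)).
  assert (Hww : dot d w w = 1) by now apply unit_dir_norm.
  assert (Hwr : residual d (dirs st) w = w) by now apply residual_unit_dir.
  assert (Hyr : residual d (dirs st) y = y) by now apply residual_idempotent.
  assert (Hpos : 0 < dot d y y) by (assert (0 <= dot d y y) by apply dot_self_ge0; lra).
  assert (Hrad : radius d st = sqrt (dot d y y)).
  { unfold radius. f_equal.
    pose proof (sqd_offset d st x y (ctr st) Hl Hyr eq_refl) as E.
    assert (E1 : offset st y = x) by now apply offset_residual.
    assert (E2 : dot d (off st) y = 0).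
    { rewrite Ho. rewrite dot_sub_l, residual_self_adjoint, Hyr. ring. }
    rewrite <- Hr.
    replace (fun t => x t - ctr st t) with (fun t => off st t + y t).
    - rewrite !dot_add_l, !dot_add_r, (dot_sym d y (off st)), E2. ring.
    - apply functional_extensionality; intro t. rewrite <- E1. unfold offset. ring. }
  set (rho := radius d st) in *.
  assert (Hrho : 0 < rho) by (rewrite Hrad; now apply sqrt_lt_R0).
  assert (Hrho2 : rho * rho = dot d y y) by (rewrite Hrad; apply sqrt_sqrt; lra).
  (* The sign is chosen so that [h * w] does not point away from [y]; the segment between them then
     misses the origin. *)
  assert (Hh : exists h, (h = rho \/ h = - rho) /\ 0 <= h * dot d y w).
  { destruct (Rle_dec 0 (dot d y w)); [exists rho|exists (- rho)]; split; auto; nra. }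
  destruct Hh as (h & Hh & Hhw).
  assert (Hh2 : h * h = dot d y y) by (destruct Hh; subst h; nra).
  enough (G : feasible d cs (cand d st h i) \/
    exists x' a r s, In (a, r, s) cs /\ located d st x' /\ feasible d cs x' /\
    sqd d x' a = r /\
    let b := residual d (dirs st) (fun t => a t - ctr st t) in dot d b b <> 0).
  { destruct G as [G|G]; [|auto]. destruct Hh; subst h; auto. }
  destruct (classic (feasible d cs (cand d st h i))) as [Hc|Hc]; [auto|right].
  (* The arc [p] is the chord [m] from [y] to [h * w], rescaled to length [rho]; [Q] is the squared
     length of the chord point. *)
  set (m := fun (z : R) t => (1 - z) * y t + (z * h) * w t).
  set (Q := fun z : R => dot d y y + (2 * h * dot d y w - 2 * dot d y y) * z +
                (2 * dot d y y - 2 * h * dot d y w) * (z * z)).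
  assert (HQ : forall z, dot d (m z) (m z) = Q z).
  { intros z. unfold m, Q. rewrite !dot_lin_l, !dot_lin_r, Hww, (dot_sym d w y).
    replace (z * h * ((1 - z) * dot d y w + z * h * 1))
      with (z * h * ((1 - z) * dot d y w) + z * z * (h * h)) by ring.
    rewrite Hh2. ring. }
  assert (HQ0 : forall z, 0 <= Q z) by (intro; rewrite <- HQ; apply dot_self_ge0).
  (* With u = z (1 - z), Q z = |y|^2 (1 - 2 u) + 2 u h <y, w>, and 1 - 2 u is at least 1/2. *)
  assert (HQpos : forall z, 0 <= z <= 1 -> 0 < Q z).
  { intros z Hz. unfold Q.
    assert (0 <= z * (1 - z)) by nra.
    assert (0 <= z * (1 - z) * (h * dot d y w)) by (apply Rmult_le_pos; auto).
    assert (0 < dot d y y * (1 - 2 * (z * (1 - z)))) by (apply Rmult_lt_0_compat; nra).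
    lra. }
  set (p := fun z => (fun t => (rho / sqrt (Q z)) * m z t)).
  assert (Hpr : forall z, residual d (dirs st) (p z) = p z).
  { intros z. unfold p. rewrite residual_scal. unfold m. rewrite residual_lin, Hyr, Hwr.
    reflexivity. }
  assert (Hpn : forall z, 0 <= z <= 1 -> dot d (p z) (p z) = dot d y y).
  { intros z Hz. unfold p. rewrite dot_scal_l, dot_scal_r, HQ, <- Hrho2.
    pose proof (HQpos z Hz). assert (0 < sqrt (Q z)) by now apply sqrt_lt_R0.
    rewrite <- (sqrt_sqrt (Q z)) at 3 by auto. field. lra. }
  assert (Hp0 : offset st (p 0) = x).
  { replace (p 0) with y; [now apply offset_residual|].
    apply functional_extensionality; intro t. unfold p, m.
    replace (Q 0) with (dot d y y) by (unfold Q; ring). rewrite <- Hrad. field. lra. }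
  assert (Hp1 : offset st (p 1) = cand d st h i).
  { apply functional_extensionality; intro t. unfold offset, cand, p, m. fold w.
    replace (Q 1) with (dot d y y) by (unfold Q; ring). rewrite <- Hrad. field. lra. }
  set (ctrd := fun (a : nat -> R) t => a t - ctr st t).
  set (K := fun a => rad2 st + dot d (ctrd a) (ctrd a) - 2 * dot d (ctrd a) (off st)).
  assert (Hsq : forall z a, 0 <= z <= 1 ->
     sqd d (offset st (p z)) a = K a - 2 * dot d (ctrd a) (p z)).
  { intros z a Hz. apply (sqd_offset d st x (p z) a); auto. }
  (* A centre whose residual vanishes has constant distance to the arc. Its sphere could be tight
     everywhere without lowering the dimension, so it is kept out of the exit argument. *)
  set (moving := fun k : (nat -> R) * R * R =>
     let b := residual d (dirs st) (ctrd (fst (fst k))) in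
     if Req_EM_T (dot d b b) 0 then false else true).
  assert (Hconst : forall a r s z, moving (a, r, s) = false -> 0 <= z <= 1 ->
     sqd d (offset st (p z)) a = sqd d x a).
  { intros a r s z Hm Hz. rewrite <- Hp0. rewrite !Hsq by (auto; lra).
    unfold moving in Hm; simpl in Hm.
    destruct (Req_EM_T _ _) as [E|]; [|discriminate].
    rewrite <- (Hpr z), <- (Hpr 0), <- !residual_self_adjoint, !(dot_null_l d _ _ E).
    reflexivity. }
  (* let '(a, r, s) := k in Multiplying the constraint by [sqrt (Q z)], which is positive on the
     arc, clears the denominator of [p] and leaves a multiple of the root plus an affine function,
     visibly continuous. *)
  set (G := fun (k : (nat -> R) * R * R) z =>
     let '(a, r, s) := k in
     s * (K a - r) * sqrt (Q z) +
     affine_fct (- 2 * s * rho * dot d (ctrd a) y)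
                (2 * s * rho * (dot d (ctrd a) y - h * dot d (ctrd a) w)) z).
  assert (HG : forall a r s z, 0 <= z <= 1 ->
     G (a, r, s) z = s * (sqd d (offset st (p z)) a - r) * sqrt (Q z)).
  { intros a r s z Hz. rewrite Hsq by auto. unfold p at 1. rewrite dot_scal_r.
    unfold m at 1. rewrite dot_lin_r. simpl G. unfold affine_fct.
    assert (0 < sqrt (Q z)) by (apply sqrt_lt_R0; auto). field. lra. }
  destruct (first_exit _ G (filter moving cs)) as (z & Hz & Hall & k & Hk & Ek).
  - intros [[a r] s] _. unfold G.
    apply (continuity_plus (mult_real_fct (s * (K a - r)) (fun z => sqrt (Q z)))).
    + apply continuity_scal. now apply continuity_sqrt_quadratic.
    + apply continuity_affine.
  - intros [[a r] s] Hin. apply filter_In in Hin as (Hin & _).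
    rewrite HG, Hp0 by lra. apply Rmult_le_pos; [now apply Hf|apply sqrt_pos].
  - apply NNPP; intros Hno. apply Hc. intros a r s Hin. rewrite <- Hp1.
    destruct (moving (a, r, s)) eqn:Em.
    + apply Rnot_lt_le; intros Hlt. apply Hno. exists (a, r, s).
      split; [now apply filter_In|]. rewrite HG by lra.
      assert (0 < sqrt (Q 1)) by (apply sqrt_lt_R0, HQpos; lra). nra.
    + rewrite (Hconst a r s 1) by (auto; lra). now apply Hf.
  - destruct k as [[a r] s]. apply filter_In in Hk as (Hin & Hm).
    assert (Hsp : 0 < sqrt (Q z)) by (apply sqrt_lt_R0, HQpos; auto).
    exists (offset st (p z)), a, r, s. split; [auto|]. split.
    { apply (located_offset d st x); auto. }
    split; [|split].
    + intros a' r' s' Hin'. destruct (moving (a', r', s')) eqn:Em.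
      * assert (H : 0 <= G (a', r', s') z) by (apply Hall, filter_In; auto).
        rewrite HG in H by auto. apply Rnot_lt_le; intros Hlt. nra.
      * rewrite (Hconst a' r' s' z) by auto. now apply Hf.
    + rewrite HG in Ek by auto. specialize (Hs a r s Hin).
      apply Rmult_integral in Ek as [Ek|Ek]; [|lra].
      apply Rmult_integral in Ek as [Ek|Ek]; [contradiction|lra].
    + unfold moving in Hm; simpl in Hm. simpl.
      destruct (Req_EM_T _ _) as [|E]; [discriminate|exact E].
Qed.

(* Each level of the search either reaches a feasible candidate or lowers the
   trace of the residual operator by one, so [d] levels are enough. *)
Lemma search_complete (d : nat) (cs : list ((nat -> R) * R * R)) (Good : nat -> state -> Prop) :
  (forall a r s, In (a, r, s) cs -> s <> 0) ->
  (forall L st, feasible d cs (cand d st 0 0) -> Good L st) ->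
  (forall L st i, (i < d)%nat -> feasible d cs (cand d st (radius d st) i) \/
      feasible d cs (cand d st (- radius d st) i) -> Good L st) ->
  (forall L st a r s, In (a, r, s) cs -> Good L (extend d st a r) -> Good (S L) st) ->
  forall L st x, trace d (dirs st) = INR L -> located d st x -> feasible d cs x -> Good L st.
Proof.
  intros Hs H0 H1 H2 L. induction L as [|L IH]; intros st x Ht Hl Hf.
  all: set (y := residual d (dirs st) (fun t => x t - ctr st t)).
  all: destruct (Req_EM_T (dot d y y) 0) as [Hy|Hy].
  (* A null residual means that [x] agrees in its first [d] coordinates with the centre of the
     intersection, the candidate with [h = 0]. *)
  1, 3: apply H0; intros a r s Hin; rewrite (sqd_ext d _ x); [now apply Hf|];
    intros t Hlt; rewrite <- (offset_residual d st x Hl); fold y;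
    unfold cand, offset; rewrite (dot_self_eq0 d y t Hy Hlt); ring.
  all: assert (Hi : exists i, (i < d)%nat /\
    dot d (residual d (dirs st) (basis i)) (residual d (dirs st) (basis i)) <> 0).
  1, 3: apply NNPP; intros Hno; apply Hy, residual_null; intros i Hi;
    apply NNPP; intros Hne; apply Hno; exists i; auto.
  all: destruct Hi as (i & Hi & Hne).
  (* Trace 0 forces every residual of a basis vector to be null, against the choice of [i]. *)
  - exfalso. destruct Hl as (Hg & _).
    pose proof (residual_basis_le_trace d (dirs st) i Hg Hi).
    pose proof (dot_self_ge0 d (residual d (dirs st) (basis i))).
    rewrite Ht in *. simpl in *. lra.
  - destruct (arc_step d cs st x i Hs Hl Hf Hy Hne) as [Hc|[Hc|Hc]]; eauto.
    destruct Hc as (x' & a & r & s & Hin & Hl' & Hf' & Ha & Hb).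
    apply (H2 L st a r s Hin). apply (IH _ x'); auto.
    + rewrite trace_extend, Ht, S_INR by auto. ring.
    + now apply located_extend.
Qed.

(** A straight move along the first coordinate ends outside the ball around [c0], so the ball
    constraint fails there and some constraint is tight on the way. *)
Lemma reach_sphere (d : nat) (cs : list ((nat -> R) * R * R)) (x c0 : nat -> R) (r0 : R) :
  (0 < d)%nat -> (forall a r s, In (a, r, s) cs -> s <> 0) -> 0 < r0 ->
  In (c0, r0, -1) cs -> feasible d cs x ->
  exists x' a r s, In (a, r, s) cs /\ feasible d cs x' /\ sqd d x' a = r.
Proof.
  intros Hd Hs Hr0 Hin0 Hf.
  (* Both M and M + 2 (x_0 - c0_0) are at least r0 + 1, so the squared distance at the end is at
     least (r0 + 1)^2, which exceeds r0. *)
  set (M := 2 * Rabs (x O - c0 O) + r0 + 1).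
  set (p := fun z : R => (fun t => x t + (M * z) * basis 0 t)).
  assert (Hsq : forall z a, sqd d (p z) a =
     sqd d x a + (2 * M * (x O - a O)) * z + (M * M) * (z * z)).
  { intros z a. rewrite !sqd_dot.
    replace (fun t => p z t - a t) with (fun t => (x t - a t) + (M * z) * basis 0 t)
      by (apply functional_extensionality; intro; unfold p; ring).
    rewrite dot_add_l, !dot_add_r, !dot_scal_l, !dot_scal_r,
      (dot_sym d (fun t => x t - a t) (basis 0)), !dot_basis by auto.
    unfold basis; simpl. ring. }
  set (G := fun (k : (nat -> R) * R * R) z => let '(a, r, s) := k in
     s * (sqd d x a - r) + (s * (2 * M * (x O - a O))) * z + (s * (M * M)) * (z * z)).
  assert (HG : forall a r s z, G (a, r, s) z = s * (sqd d (p z) a - r)).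
  { intros. rewrite Hsq. unfold G. ring. }
  assert (Hp0 : p 0 = x) by (apply functional_extensionality; intro; unfold p; ring).
  destruct (first_exit _ G cs) as (z & Hz & Hall & k & Hk & Ek).
  - intros [[a r] s] _. apply continuity_quadratic.
  - intros [[a r] s] Hin. rewrite HG, Hp0. now apply Hf.
  - exists (c0, r0, -1). split; [auto|]. rewrite HG, Hsq.
    assert (0 <= sqd d x c0) by (rewrite sqd_dot; apply dot_self_ge0).
    assert (r0 + 1 <= M + 2 * (x O - c0 O) /\ r0 + 1 <= M)
      by (unfold M, Rabs; destruct (Rcase_abs (x O - c0 O)); lra).
    assert ((r0 + 1) * (r0 + 1) <= M * (M + 2 * (x O - c0 O))) by (apply Rmult_le_compat; lra).
    nra.
  - destruct k as [[a r] s]. exists (p z), a, r, s. split; [auto|]. split.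
    + intros a' r' s' Hin'. rewrite <- HG. now apply Hall.
    + rewrite HG in Ek. specialize (Hs a r s Hk).
      apply Rmult_integral in Ek as [Ek|Ek]; [contradiction|lra].
Qed.

(** * The search *)

Record inst := Inst
  { nc : nat; nv : nat; cand_at : nat -> nat -> R; voter_at : nat -> nat -> R;
    rule : nat -> R; bound : R }.

Fixpoint sumN (n : nat) (g : nat -> nat) : nat :=
  match n with O => O | S n' => (sumN n' g + g n')%nat end.

(** A number instead of a truth value: disjunctions over tuples of spheres turn into sums, which
    loops accumulate. The shift [S j] skips candidate 0, the target. *)
Definition test (d : nat) (I : inst) (x : nat -> R) : nat :=
  countN (nc I - 1) (fun j =>
    Rleb (dist d x (cand_at I 0)) (bound I) &&
    Rleb (score_target d (nc I) (nv I) (cand_at I) (voter_at I) (rule I) x)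
         (score_other d (nc I) (nv I) (cand_at I) (voter_at I) (rule I) x (S j))).

Definition test_state (d : nat) (I : inst) (st : state) : nat :=
  (test d I (cand d st 0 0) +
   sumN d (fun i => test d I (cand d st (radius d st) i) +
                    test d I (cand d st (- radius d st) i)))%nat.

Definition over_spheres (d : nat) (I : inst) (F : (nat -> R) -> R -> nat) : nat :=
  (F (cand_at I 0) (bound I * bound I)%R +
   sumN (nv I) (fun k => sumN (nc I) (fun l =>
     F (voter_at I k) (sqd d (voter_at I k) (cand_at I l)))))%nat.

(** Each level also tests its own state, since the path may end at a candidate before all extensions
    are used up. *)
Fixpoint search (d : nat) (I : inst) (L : nat) (st : state) : nat :=
  match L with
  | O => test_state d I st
  | S L' => (test_state d I st +
             over_spheres d I (fun a r => search d I L' (extend d st a r)))%nat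
  end.

Definition solve (d : nat) (I : inst) : nat :=
  over_spheres d I (fun a r => search d I d (start a r)).

(** * Counts and comparisons *)

Lemma Rleb_true (a b : R) : Rleb a b = true <-> a <= b.
Proof. unfold Rleb. destruct (Rle_dec a b); split; auto; try discriminate; contradiction. Qed.

Lemma Rltb_true (a b : R) : Rltb a b = true <-> a < b.
Proof. unfold Rltb. destruct (Rlt_dec a b); split; auto; try discriminate; contradiction. Qed.

Lemma countN_pos (n : nat) (P : nat -> bool) :
  (0 < countN n P)%nat <-> exists i, (i < n)%nat /\ P i = true.
Proof.
  induction n as [|n IH]; simpl.
  - split; [lia|]. intros (i & Hi & _); lia.
  - split.
    + intros H. destruct (P n) eqn:E; [exists n; auto|].
      destruct IH as [IH _]. destruct IH as (i & Hi & Hp); [lia|]. exists i; auto.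
    + intros (i & Hi & Hp). destruct (Nat.eq_dec i n) as [->|Hne].
      * rewrite Hp; lia.
      * enough (0 < countN n P)%nat by lia. apply IH. exists i; split; auto; lia.
Qed.

Lemma sumN_pos (n : nat) (g : nat -> nat) :
  (0 < sumN n g)%nat <-> exists i, (i < n)%nat /\ (0 < g i)%nat.
Proof.
  induction n as [|n IH]; simpl.
  - split; [lia|]. intros (i & Hi & _); lia.
  - split.
    + intros H. destruct (Nat.eq_dec (g n) 0) as [E|E]; [|exists n; split; lia].
      destruct IH as [IH _]. destruct IH as (i & Hi & Hp); [lia|]. exists i; auto.
    + intros (i & Hi & Hp). destruct (Nat.eq_dec i n) as [->|Hne]; [lia|].
      enough (0 < sumN n g)%nat by lia. apply IH. exists i; split; auto; lia.
Qed.

Lemma countN_le (n : nat) (P Q : nat -> bool) :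
  (forall i, (i < n)%nat -> P i = true -> Q i = true) -> (countN n P <= countN n Q)%nat.
Proof.
  induction n as [|n IH]; simpl; intros H; [lia|].
  assert (countN n P <= countN n Q)%nat by auto.
  destruct (P n) eqn:E; [rewrite (H n) by auto|]; lia.
Qed.

Lemma countN_le_n (n : nat) (P : nat -> bool) : (countN n P <= n)%nat.
Proof. induction n as [|n IH]; simpl; [lia|]. destruct (P n); lia. Qed.

Lemma countN_lt (n i : nat) (P : nat -> bool) :
  (i < n)%nat -> P i = false -> (countN n P < n)%nat.
Proof.
  induction n as [|n IH]; simpl; intros Hi Hp; [lia|].
  destruct (Nat.eq_dec i n) as [->|Hne].
  - rewrite Hp. pose proof (countN_le_n n P). lia.
  - assert (countN n P < n)%nat by (apply IH; auto; lia). destruct (P n); lia.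
Qed.

(** The two excluded indices are the target and the candidate being ranked; the spare place absorbs
    the separate summand for the target in [rank_other]. *)
Lemma countN_lt2 (n i j : nat) (P : nat -> bool) :
  (i < j < n)%nat -> P i = false -> P j = false -> (S (countN n P) < n)%nat.
Proof.
  induction n as [|n IH]; simpl; intros Hi Hp Hq; [lia|].
  destruct (Nat.eq_dec j n) as [->|Hne].
  - rewrite Hq. assert (countN n P < n)%nat by (apply (countN_lt n i); auto; lia). lia.
  - assert (S (countN n P) < n)%nat by (apply IH; auto; lia). destruct (P n); lia.
Qed.

Lemma sumV_le (m : nat) (g h : nat -> R) :
  (forall k, (k < m)%nat -> g k <= h k) -> sumV m g <= sumV m h.
Proof.
  induction m as [|m IH]; simpl; intros H; [lra|].
  assert (sumV m g <= sumV m h) by auto. assert (g m <= h m) by auto. lra.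
Qed.

(** * Soundness of the search *)

Definition valid (d : nat) (I : inst) : Prop :=
  valid_instance d (nc I) (nv I) (cand_at I) (voter_at I) (rule I) (bound I).

Definition winnable (d : nat) (I : inst) : Prop :=
  destructive_yes d (nc I) (nv I) (cand_at I) (voter_at I) (rule I) (bound I).

Lemma test_sound (d : nat) (I : inst) (x : nat -> R) :
  (0 < test d I x)%nat -> winnable d I.
Proof.
  unfold test. rewrite countN_pos. intros (j & Hj & H).
  rewrite andb_true_iff, !Rleb_true in H. destruct H as (H1 & H2).
  exists x. split; [exact H1|]. exists (S j). split; [lia|]. now apply Rle_ge.
Qed.

Lemma test_state_sound (d : nat) (I : inst) (st : state) :
  (0 < test_state d I st)%nat -> winnable d I.
Proof.
  unfold test_state. intros H.
  destruct (Nat.eq_dec (test d I (cand d st 0 0)) 0) as [E|E].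
  - destruct (proj1 (sumN_pos d (fun i => test d I (cand d st (radius d st) i) +
                    test d I (cand d st (- radius d st) i))%nat)) as (i & _ & Hi); [lia|].
    destruct (Nat.eq_dec (test d I (cand d st (radius d st) i)) 0) as [E'|E'].
    + apply (test_sound d I (cand d st (- radius d st) i)). lia.
    + apply (test_sound d I (cand d st (radius d st) i)). lia.
  - apply (test_sound d I (cand d st 0 0)). lia.
Qed.

Lemma over_spheres_pos (d : nat) (I : inst) (F : (nat -> R) -> R -> nat) :
  (0 < over_spheres d I F)%nat <->
  (0 < F (cand_at I 0) (bound I * bound I)%R)%nat \/
  exists k l, (k < nv I)%nat /\ (l < nc I)%nat /\
    (0 < F (voter_at I k) (sqd d (voter_at I k) (cand_at I l)))%nat.
Proof.
  unfold over_spheres.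
  set (A := F (cand_at I 0%nat) (bound I * bound I)).
  set (B := sumN (nv I) _).
  assert (HB : (0 < B)%nat <-> exists k l, (k < nv I)%nat /\ (l < nc I)%nat /\
    (0 < F (voter_at I k) (sqd d (voter_at I k) (cand_at I l)))%nat).
  { unfold B. rewrite sumN_pos. split.
    - intros (k & Hk & H). apply sumN_pos in H as (l & Hl & H). exists k, l; auto.
    - intros (k & l & Hk & Hl & H). exists k; split; auto. apply sumN_pos. exists l; auto. }
  rewrite <- HB. lia.
Qed.

Lemma over_spheres_sound (d : nat) (I : inst) (F : (nat -> R) -> R -> nat) (P : Prop) :
  (forall a r, (0 < F a r)%nat -> P) -> (0 < over_spheres d I F)%nat -> P.
Proof.
  intros H HF. apply over_spheres_pos in HF as [H'|(k & l & _ & _ & H')]; eauto.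
Qed.

Lemma search_sound (d : nat) (I : inst) (L : nat) (st : state) :
  (0 < search d I L st)%nat -> winnable d I.
Proof.
  revert st. induction L as [|L IH]; simpl; intros st H; [now apply (test_state_sound d I st)|].
  destruct (Nat.eq_dec (test_state d I st) 0).
  - apply (over_spheres_sound d I (fun a r => search d I L (extend d st a r)));
      [intros a r; apply IH|lia].
  - apply (test_state_sound d I st); lia.
Qed.

(** * Completeness of the search *)

Lemma dist_sqd (d : nat) (x y : nat -> R) : dist d x y = sqrt (sqd d x y).
Proof. reflexivity. Qed.

Lemma sqd_sym (d : nat) (x y : nat -> R) : sqd d x y = sqd d y x.
Proof. apply sumR_ext; intros; ring. Qed.

Lemma sqd_ge0 (d : nat) (x y : nat -> R) : 0 <= sqd d x y.
Proof. rewrite sqd_dot. apply dot_self_ge0. Qed.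

(** The rule is monotone, and present in the input, only for ranks 1 to n, so ranks must be shown to
    stay in this range. *)
Lemma rank_target_le (d n : nat) (c : nat -> nat -> R) (x vk : nat -> R) :
  (1 <= n)%nat -> (rank_target d n c x vk <= n)%nat.
Proof. intros Hn. apply (countN_lt _ 0); [lia|reflexivity]. Qed.

Lemma rank_other_le (d n : nat) (c : nat -> nat -> R) (x vk : nat -> R) (j : nat) :
  (1 <= j < n)%nat -> (rank_other d n c x vk j <= n)%nat.
Proof.
  intros Hj. unfold rank_other.
  assert (S (countN n (fun l => negb (Nat.eqb l 0) && negb (Nat.eqb l j) &&
     Rltb (dist d vk (c l)) (dist d vk (c j)))) < n)%nat.
  { apply (countN_lt2 _ 0 j); [lia|reflexivity|].
    rewrite Nat.eqb_refl, andb_false_r. reflexivity. }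
  destruct (Rltb (dist d vk x) (dist d vk (c j))); lia.
Qed.

(* The rule being non-increasing, moving the target farther from the voters never
   helps it. *)
Lemma test_farther (d : nat) (I : inst) (x z : nat -> R) (j : nat) :
  valid d I -> (1 <= j < nc I)%nat ->
  score_other d (nc I) (nv I) (cand_at I) (voter_at I) (rule I) x j >=
  score_target d (nc I) (nv I) (cand_at I) (voter_at I) (rule I) x ->
  dist d z (cand_at I 0%nat) <= bound I ->
  (forall k l, (k < nv I)%nat -> (l < nc I)%nat ->
     dist d (voter_at I k) (cand_at I l) <= dist d (voter_at I k) x ->
     dist d (voter_at I k) (cand_at I l) <= dist d (voter_at I k) z) ->
  (0 < test d I z)%nat.
Proof.
  intros (Hn & He & Hf & _) Hj Hwin Hz Hmono.
  unfold test. apply countN_pos. exists (j - 1)%nat. split; [lia|].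
  replace (S (j - 1)) with j by lia.
  rewrite andb_true_iff, !Rleb_true. split; [exact Hz|].
  apply Rle_trans with (score_target d (nc I) (nv I) (cand_at I) (voter_at I) (rule I) x).
  - apply sumV_le. intros k Hk. apply Hf.
    + unfold rank_target; lia.
    + unfold rank_target. apply le_n_S, countN_le. intros l Hl.
      rewrite !andb_true_iff, !Rleb_true. intros (H1 & H2). auto.
    + apply rank_target_le; lia.
  - apply Rle_trans with (score_other d (nc I) (nv I) (cand_at I) (voter_at I) (rule I) x j);
      [lra|].
    apply sumV_le. intros k Hk. apply Hf.
    + unfold rank_other; lia.
    + unfold rank_other. apply le_n_S, Nat.add_le_mono_l.
      destruct (Rltb (dist d (voter_at I k) z) (dist d (voter_at I k) (cand_at I j))) eqn:E;
        [|lia].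
      destruct (Rltb (dist d (voter_at I k) x) (dist d (voter_at I k) (cand_at I j))) eqn:E';
        [lia|].
      (* If [x] is not closer than candidate [j], the weak inequality carries over to [z], which
         therefore cannot be strictly closer. *)
      exfalso. apply Rltb_true in E.
      assert (~ dist d (voter_at I k) x < dist d (voter_at I k) (cand_at I j))
        by (rewrite <- Rltb_true, E'; discriminate).
      assert (dist d (voter_at I k) (cand_at I j) <= dist d (voter_at I k) z)
        by (apply Hmono; auto; [lia|lra]).
      lra.
    + apply rank_other_le; lia.
Qed.

(* The closed sign conditions satisfied by [x], plus the ball of allowed moves. *)
Definition constraints (d : nat) (I : inst) (x : nat -> R) : list ((nat -> R) * R * R) :=
  (cand_at I 0%nat, bound I * bound I, -1) ::
  flat_map (fun k => map (fun l =>
      (voter_at I k, sqd d (voter_at I k) (cand_at I l),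
       if Rle_dec (sqd d (voter_at I k) (cand_at I l)) (sqd d x (voter_at I k)) then 1 else -1))
    (seq 0 (nc I))) (seq 0 (nv I)).

Lemma in_constraints (d : nat) (I : inst) (x a : nat -> R) (r s : R) :
  In (a, r, s) (constraints d I x) <->
  (a = cand_at I 0%nat /\ r = bound I * bound I /\ s = -1) \/
  exists k l, (k < nv I)%nat /\ (l < nc I)%nat /\ a = voter_at I k /\
    r = sqd d (voter_at I k) (cand_at I l) /\
    s = if Rle_dec r (sqd d x a) then 1 else -1.
Proof.
  unfold constraints; simpl. rewrite in_flat_map. split.
  - intros [E|(k & Hk & H)].
    + left. inversion E; auto.
    + right. apply in_map_iff in H as (l & E & Hl). apply in_seq in Hk, Hl.
      inversion E; subst. exists k, l. repeat split; lia.
  - intros [(-> & -> & ->)|(k & l & Hk & Hl & -> & -> & ->)]; [left; auto|right].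
    exists k. split; [apply in_seq; lia|]. apply in_map_iff. exists l.
    split; [reflexivity|apply in_seq; lia].
Qed.

Lemma constraints_sign (d : nat) (I : inst) (x a : nat -> R) (r s : R) :
  In (a, r, s) (constraints d I x) -> s <> 0.
Proof.
  rewrite in_constraints. intros [(_ & _ & ->)|(k & l & _ & _ & _ & _ & ->)]; [lra|].
  destruct (Rle_dec _ _); lra.
Qed.

Lemma dist_le_bound (d : nat) (x y : nat -> R) (e : R) :
  0 < e -> dist d x y <= e <-> sqd d x y <= e * e.
Proof.
  intros He. rewrite dist_sqd. rewrite <- (sqrt_square e) at 1 by lra. split; intros H.
  - apply sqrt_le_0; auto; [apply sqd_ge0|nra].
  - apply sqrt_le_1_alt; auto.
Qed.

Lemma feasible_self (d : nat) (I : inst) (x : nat -> R) :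
  0 < bound I -> dist d x (cand_at I 0%nat) <= bound I -> feasible d (constraints d I x) x.
Proof.
  intros He Hx a r s. rewrite in_constraints.
  intros [(-> & -> & ->)|(k & l & _ & _ & _ & _ & ->)].
  - apply dist_le_bound in Hx; auto. lra.
  - destruct (Rle_dec _ _); lra.
Qed.

Lemma feasible_test (d : nat) (I : inst) (x z : nat -> R) (j : nat) :
  valid d I -> (1 <= j < nc I)%nat ->
  score_other d (nc I) (nv I) (cand_at I) (voter_at I) (rule I) x j >=
  score_target d (nc I) (nv I) (cand_at I) (voter_at I) (rule I) x ->
  feasible d (constraints d I x) z -> (0 < test d I z)%nat.
Proof.
  intros Hv Hj Hwin Hz. apply (test_farther d I x z j); auto.
  - pose proof Hv as (_ & He & _). apply dist_le_bound; auto.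
    assert (H : 0 <= -1 * (sqd d z (cand_at I 0%nat) - bound I * bound I))
      by (apply Hz, in_constraints; auto).
    lra.
  - intros k l Hk Hl H. rewrite !dist_sqd in *.
    apply sqrt_le_0 in H; auto using sqd_ge0.
    apply sqrt_le_1_alt. rewrite (sqd_sym d _ z). rewrite (sqd_sym d _ x) in H.
    assert (H' : 0 <= (if Rle_dec (sqd d (voter_at I k) (cand_at I l)) (sqd d x (voter_at I k))
         then 1 else -1) * (sqd d z (voter_at I k) - sqd d (voter_at I k) (cand_at I l))).
    { apply Hz, in_constraints. right. exists k, l. auto. }
    destruct (Rle_dec _ _); [lra|contradiction].
Qed.

Lemma over_spheres_constraint (d : nat) (I : inst) (F : (nat -> R) -> R -> nat)
    (x a : nat -> R) (r s : R) :
  In (a, r, s) (constraints d I x) -> (0 < F a r)%nat -> (0 < over_spheres d I F)%nat.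
Proof.
  rewrite in_constraints, over_spheres_pos.
  intros [(-> & -> & _)|(k & l & Hk & Hl & -> & -> & _)] H; [auto|].
  right. exists k, l; auto.
Qed.

Lemma solve_correct (d : nat) (I : inst) :
  (0 < d)%nat -> valid d I -> (0 < solve d I)%nat <-> winnable d I.
Proof.
  intros Hpos Hv. split.
  - apply over_spheres_sound. intros a r. apply search_sound.
  - intros (x & Hx & j & Hj & Hwin).
    pose proof Hv as (_ & He & _).
    pose proof (feasible_self d I x He Hx) as Hf.
    assert (HT : forall z, feasible d (constraints d I x) z -> (0 < test d I z)%nat)
      by (intros z; apply (feasible_test d I x z j); auto).
    assert (H1 : forall st, feasible d (constraints d I x) (cand d st 0 0) ->
        (0 < test_state d I st)%nat)
      by (intros st H; apply HT in H; unfold test_state; lia).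
    assert (H2 : forall st i, (i < d)%nat ->
       feasible d (constraints d I x) (cand d st (radius d st) i) \/
       feasible d (constraints d I x) (cand d st (- radius d st) i) ->
       (0 < test_state d I st)%nat).
    { intros st i Hi H. unfold test_state. apply Nat.add_pos_r, sumN_pos.
      exists i; split; auto. destruct H as [H|H]; apply HT in H; lia. }
    assert (H3 : forall L st, (0 < test_state d I st)%nat -> (0 < search d I L st)%nat)
      by (intros [|L] st; simpl; lia).
    destruct (reach_sphere d (constraints d I x) x (cand_at I 0%nat) (bound I * bound I))
      as (x' & a & r & s & Hin & Hf' & Ha); auto.
    + apply constraints_sign.
    + nra.
    + apply in_constraints; auto.
    (* The sphere touched by the straight path is the starting state. Its empty list of normals has
       trace [d], so [d] levels of extension suffice. *)
    + apply (over_spheres_constraint d I _ x a r s Hin).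
      apply (search_complete d (constraints d I x)
               (fun L st => (0 < search d I L st)%nat)) with x'; auto.
      * apply constraints_sign.
      * intros L st i Hi H. apply H3, (H2 st i); auto.
      * intros L st b r' s' Hin' H. simpl. apply Nat.add_pos_r.
        apply (over_spheres_constraint d I _ x b r' s' Hin'). exact H.
      * apply trace_nil.
      * now apply located_start.
Qed.

(** * Program fragments *)

(** Exact step counts make runs compose by addition; fuel enters only at the very end, through
    [exec_runs]. *)
Inductive runs (P : program) : config -> nat -> config -> Prop :=
| runs_refl s : runs P s 0 s
| runs_step s ins t s' :
    nth_error P (pc s) = Some ins -> runs P (step ins s) t s' -> runs P s (S t) s'.

Lemma runs_trans (P : program) (s1 s2 s3 : config) (t1 t2 : nat) :
  runs P s1 t1 s2 -> runs P s2 t2 s3 -> runs P s1 (t1 + t2) s3.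
Proof.
  induction 1; simpl; intros; auto. econstructor; eauto.
Qed.

Lemma runs_one (P : program) (s s' : config) (ins : instr) :
  nth_error P (pc s) = Some ins -> step ins s = s' -> runs P s 1 s'.
Proof. intros H <-. econstructor; [eauto|constructor]. Qed.

Lemma exec_runs (P : program) (s s' : config) (t fuel : nat) :
  runs P s t s' -> nth_error P (pc s') = None -> (t <= fuel)%nat ->
  exec P fuel s = Some s'.
Proof.
  intros H. revert fuel. induction H as [s|s ins t s' Hn Hr IH]; intros fuel He Hf.
  - destruct fuel; simpl; rewrite He; reflexivity.
  - destruct fuel as [|fuel]; [lia|]. simpl. rewrite Hn. apply IH; auto; lia.
Qed.

Definition installed (P : program) (b : nat) (l : list instr) : Prop :=
  forall i ins, nth_error l i = Some ins -> nth_error P (b + i) = Some ins.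

Lemma installed_app (P : program) (b : nat) (l1 l2 : list instr) :
  installed P b (l1 ++ l2) -> installed P b l1 /\ installed P (b + length l1) l2.
Proof.
  intros H. split; intros i ins Hi.
  - apply H. rewrite nth_error_app1; auto. apply nth_error_Some. congruence.
  - rewrite <- Nat.add_assoc. apply H. rewrite nth_error_app2 by lia.
    now replace (length l1 + i - length l1)%nat with i by lia.
Qed.

Lemma installed_cons (P : program) (b : nat) (ins : instr) (l : list instr) :
  installed P b (ins :: l) -> nth_error P b = Some ins /\ installed P (S b) l.
Proof.
  intros H. split.
  - rewrite <- (Nat.add_0_r b). now apply H.
  - intros i ins' Hi. replace (S b + i)%nat with (b + S i)%nat by lia. now apply H.
Qed.

Lemma upd_same (A : Type) (g : nat -> A) (i : nat) (a : A) : upd g i a i = a.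
Proof. unfold upd. now rewrite Nat.eqb_refl. Qed.

Lemma upd_other (A : Type) (g : nat -> A) (i j : nat) (a : A) : j <> i -> upd g i a j = g j.
Proof. unfold upd. intros H. destruct (Nat.eqb_spec j i); congruence. Qed.

Ltac regs := cbn [nreg rreg pc]; repeat first
  [rewrite upd_same | rewrite upd_other by lia].

Definition mem_size (d : nat) (I : inst) : nat := (1 + nc I + nc I * d + nv I * d)%nat.

Definition size_of (d : nat) (I : inst) : nat := input_size d (nc I) (nv I).

Definition start_config (d : nat) (I : inst) : config :=
  init_config d (nc I) (nv I) (cand_at I) (voter_at I) (rule I) (bound I).

Definition input (d : nat) (I : inst) : nat -> R := rreg (start_config d I).

(* The values of an element of the carrier are kept by the machine in the
   registers N[0], N[1] (numbers of candidates and voters), in one N-register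
   per loop variable, and in the copy of the input that starts at R[N[2]]. *)
Record ctx := Ctx
  { carrier :> Type; inst_of : carrier -> inst; nvars : nat;
    var : carrier -> nat -> nat; dom : carrier -> Prop }.

(** The context of a loop body. That the new variable stays below [B] is recorded in the domain,
    which is how index bounds reach the reads of the input. *)
Definition ctx_ext (G : ctx) (B : G -> nat) : ctx :=
  Ctx (G * nat) (fun p => inst_of G (fst p)) (S (nvars G))
      (fun p i => if Nat.eqb i (nvars G) then snd p else var G (fst p) i)
      (fun p => dom G (fst p) /\ (snd p < B (fst p))%nat).

Definition rep (d : nat) (G : ctx) (loc : nat -> nat) (g : G) (N : nat -> nat) (M : nat -> R)
  : Prop :=
  N 0%nat = nc (inst_of G g) /\ N 1%nat = nv (inst_of G g) /\
  (forall i, (i < nvars G)%nat -> N (loc i) = var G g i) /\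
  (forall a, (a < mem_size d (inst_of G g))%nat ->
     M (N 2%nat + a)%nat = input d (inst_of G g) a).

Definition frame (h r : nat) (N : nat -> nat) (M : nat -> R) (N' : nat -> nat) (M' : nat -> R)
  : Prop :=
  (forall i, (i < h)%nat -> N' i = N i) /\ (forall i, (i < r)%nat -> M' i = M i) /\
  (forall i, (N 2%nat <= i)%nat -> M' i = M i).

Definition allocated (G : ctx) (loc : nat -> nat) (h : nat) : Prop :=
  (3 <= h)%nat /\ forall i, (i < nvars G)%nat -> (loc i < h)%nat.

Definition assertion (G : ctx) := G -> (nat -> nat) -> (nat -> R) -> Prop.

(* Some relocatable fragment of constant length takes [Pre] to [Post] in
   polynomial time, touching only N-registers from [h] on and R-registers
   between [r] and the copy of the input. *)
Definition hoare (d : nat) (G : ctx) (loc : nat -> nat) (h r : nat) (Pre Post : assertion G)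
  : Prop :=
  exists (code : nat -> list instr) (len K a k : nat),
    (forall b, length (code b) = len) /\
    forall g P b N M, dom G g -> installed P b (code b) -> (K <= N 2)%nat ->
      rep d G loc g N M -> Pre g N M ->
      exists t N' M', runs P (Config b N M) t (Config (b + len) N' M') /\
        (t <= a * size_of d (inst_of G g) ^ k)%nat /\
        frame h r N M N' M' /\ Post g N' M'.

(** * Polynomial bounds and composition rules for fragments *)

Lemma size_of_pos (d : nat) (I : inst) : (1 <= size_of d I)%nat.
Proof. unfold size_of, input_size. lia. Qed.

Lemma pow_pos (s k : nat) : (1 <= s)%nat -> (1 <= s ^ k)%nat.
Proof. intros H. induction k; simpl; nia. Qed.

Lemma poly_add (s a1 k1 a2 k2 : nat) :
  (1 <= s)%nat -> (a1 * s ^ k1 + a2 * s ^ k2 <= (a1 + a2) * s ^ (k1 + k2))%nat.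
Proof.
  intros H. rewrite Nat.pow_add_r.
  pose proof (pow_pos s k1 H). pose proof (pow_pos s k2 H).
  set (x := (s ^ k1)%nat) in *. set (y := (s ^ k2)%nat) in *.
  assert (x <= x * y)%nat by nia. assert (y <= x * y)%nat by nia.
  rewrite Nat.mul_add_distr_r.
  apply Nat.add_le_mono; apply Nat.mul_le_mono_l; auto.
Qed.

(** 3 counts the two initializations and the final test of a loop, 4 the test, the two updates and
    the jump of each iteration; their sum is the 7 on the right. *)
Lemma poly_loop (s a k n : nat) :
  (1 <= s)%nat -> (n <= s)%nat -> (3 + n * (a * s ^ k + 4) <= (a + 7) * s ^ (S k))%nat.
Proof.
  intros Hs Hn. simpl. pose proof (pow_pos s k Hs). set (x := (s ^ k)%nat) in *.
  assert (n * (a * x + 4) <= s * (a * x + 4))%nat by (apply Nat.mul_le_mono_r; auto).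
  assert (1 <= s * x)%nat by nia. assert (s <= s * x)%nat by nia.
  assert (s * (a * x + 4) = a * (s * x) + 4 * s)%nat by ring.
  rewrite Nat.mul_add_distr_r. lia.
Qed.

Lemma rep_frame (d : nat) (G : ctx) (loc : nat -> nat) (h r : nat) (g : G) N M N' M' :
  allocated G loc h -> frame h r N M N' M' -> rep d G loc g N M -> rep d G loc g N' M'.
Proof.
  intros (Hh & Hl) (F1 & F2 & F3) (R0 & R1 & Rv & Ri).
  repeat split.
  - rewrite F1; auto; lia.
  - rewrite F1; auto; lia.
  - intros i Hi. rewrite F1; auto.
  - intros a Ha. rewrite (F1 2%nat) by lia. rewrite F3 by lia. auto.
Qed.

Lemma frame_trans (h r : nat) N M N' M' N'' M'' :
  (3 <= h)%nat -> frame h r N M N' M' -> frame h r N' M' N'' M'' -> frame h r N M N'' M''.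
Proof.
  intros Hh (A1 & A2 & A3) (B1 & B2 & B3). repeat split; intros i Hi.
  - rewrite B1, A1; auto.
  - rewrite B2, A2; auto.
  - rewrite B3, A3; auto. rewrite A1; auto; lia.
Qed.

Lemma frame_le (h r h' r' : nat) N M N' M' :
  (h <= h')%nat -> (r <= r')%nat -> frame h' r' N M N' M' -> frame h r N M N' M'.
Proof.
  intros Hh Hr (A1 & A2 & A3). repeat split; intros i Hi; auto; [apply A1|apply A2]; lia.
Qed.

Lemma hoare_le (d : nat) (G : ctx) loc (h r h' r' : nat) (Pre Post : assertion G) :
  (h <= h')%nat -> (r <= r')%nat -> hoare d G loc h' r' Pre Post -> hoare d G loc h r Pre Post.
Proof.
  intros Hh Hr (code & len & K & a & k & Hlen & H).
  exists code, len, K, a, k. split; auto.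
  intros g P b N M H1 H2 H3 H4 H5.
  destruct (H g P b N M H1 H2 H3 H4 H5) as (t & N' & M' & E1 & E2 & E3 & E4).
  exists t, N', M'. repeat split; auto; apply (frame_le h r h' r' N M N' M'); auto.
Qed.

Lemma hoare_conseq (d : nat) (G : ctx) loc (h r : nat) (Pre Pre' Post Post' : assertion G) :
  (forall g N M, dom G g -> Pre' g N M -> Pre g N M) ->
  (forall g N M, dom G g -> Post g N M -> Post' g N M) ->
  hoare d G loc h r Pre Post -> hoare d G loc h r Pre' Post'.
Proof.
  intros Hp Hq (code & len & K & a & k & Hlen & H).
  exists code, len, K, a, k. split; auto.
  intros g P b N M H1 H2 H3 H4 H5.
  destruct (H g P b N M H1 H2 H3 H4 (Hp _ _ _ H1 H5)) as (t & N' & M' & E1 & E2 & E3 & E4).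
  exists t, N', M'. auto.
Qed.

(** Frame rule: lets a value already computed survive the computation of the next one. *)
Lemma hoare_keep (d : nat) (G : ctx) loc (h r : nat) (Pre Post Q : assertion G) :
  (forall g N M N' M', frame h r N M N' M' -> Q g N M -> Q g N' M') ->
  hoare d G loc h r Pre Post ->
  hoare d G loc h r (fun g N M => Q g N M /\ Pre g N M) (fun g N M => Q g N M /\ Post g N M).
Proof.
  intros HQ (code & len & K & a & k & Hlen & H).
  exists code, len, K, a, k. split; auto.
  intros g P b N M H1 H2 H3 H4 (Hq & H5).
  destruct (H g P b N M H1 H2 H3 H4 H5) as (t & N' & M' & E1 & E2 & E3 & E4).
  exists t, N', M'. repeat split; auto; try apply E3. eapply HQ; eauto.
Qed.

Lemma hoare_seq (d : nat) (G : ctx) loc (h r : nat) (Pre Mid Post : assertion G) :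
  allocated G loc h ->
  hoare d G loc h r Pre Mid -> hoare d G loc h r Mid Post -> hoare d G loc h r Pre Post.
Proof.
  intros Ha (c1 & l1 & K1 & a1 & k1 & Hl1 & H1) (c2 & l2 & K2 & a2 & k2 & Hl2 & H2).
  exists (fun b => c1 b ++ c2 (b + l1)%nat), (l1 + l2)%nat, (Nat.max K1 K2),
    (a1 + a2)%nat, (k1 + k2)%nat.
  split; [intros b; rewrite length_app, Hl1, Hl2; auto|].
  intros g P b N M Hd Hi HK Hr Hp.
  apply installed_app in Hi as (Hi1 & Hi2). rewrite Hl1 in Hi2.
  destruct (H1 g P b N M Hd Hi1) as (t1 & N1 & M1 & E1 & T1 & F1 & P1); auto; [lia|].
  destruct (H2 g P (b + l1)%nat N1 M1 Hd Hi2) as (t2 & N2 & M2 & E2 & T2 & F2 & P2); auto.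
  - destruct F1 as (F1 & _). rewrite F1; [lia|]. destruct Ha; lia.
  - eapply rep_frame; eauto.
  - exists (t1 + t2)%nat, N2, M2. split; [|split; [|split]]; auto.
    + rewrite Nat.add_assoc. eapply runs_trans; eauto.
    + eapply Nat.le_trans; [apply Nat.add_le_mono; eauto|]. apply poly_add, size_of_pos.
    + apply (frame_trans h r N M N1 M1); auto. apply Ha.
Qed.

Lemma hoare_instr (d : nat) (G : ctx) loc (h r K : nat) (ins : instr) (Pre Post : assertion G) :
  (forall g p N M, dom G g -> (K <= N 2)%nat -> rep d G loc g N M -> Pre g N M ->
     exists N' M', step ins (Config p N M) = Config (S p) N' M' /\
       frame h r N M N' M' /\ Post g N' M') ->
  hoare d G loc h r Pre Post.
Proof.
  intros H. exists (fun _ => ins :: nil), 1%nat, K, 1%nat, 0%nat. split; [reflexivity|].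
  intros g P b N M Hd Hi HK Hr Hp. apply installed_cons in Hi as (Hi & _).
  destruct (H g b N M Hd HK Hr Hp) as (N' & M' & E & F & Q).
  exists 1%nat, N', M'. repeat split; auto; try apply F.
  apply (runs_one _ _ _ ins); auto. rewrite E. f_equal. lia.
Qed.

Lemma frame_upd_N (h r i x : nat) N M : (h <= i)%nat -> frame h r N M (upd N i x) M.
Proof. intros H. repeat split; intros j Hj. apply upd_other. lia. Qed.

Lemma frame_upd_R (h r i : nat) (x : R) N M :
  (r <= i < N 2%nat)%nat -> frame h r N M N (upd M i x).
Proof. intros H. repeat split; intros j Hj; apply upd_other; lia. Qed.

(* Registers: [h] counts the remaining iterations, [h + 1] holds the loop
   variable and [h + 2] the constant 1. *)
Lemma hoare_for (d : nat) (G : ctx) loc (h r : nat) (B : G -> nat)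
    (Inv : G -> nat -> (nat -> nat) -> (nat -> R) -> Prop) :
  allocated G loc h ->
  (forall g, dom G g -> (B g <= size_of d (inst_of G g))%nat) ->
  (forall g i N N' M, (forall x, (h + 3 <= x)%nat -> N' x = N x) ->
     Inv g i N M -> Inv g i N' M) ->
  hoare d (ctx_ext G B) (upd loc (nvars G) (h + 1)%nat) (h + 3) r
     (fun p N M => Inv (fst p) (snd p) N M) (fun p N M => Inv (fst p) (S (snd p)) N M) ->
  hoare d G loc h r (fun g N M => N h = B g /\ Inv g 0%nat N M) (fun g N M => Inv g (B g) N M).
Proof.
  intros (Hh & Hloc) HB Hst (code & len & K & a & k & Hlen & H).
  exists (fun b => NSet (h + 1) 0 :: NSet (h + 2) 1 :: NJz h (b + (len + 6)) :: nil ++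
            code (b + 3)%nat ++
            NAdd (h + 1) (h + 1) (h + 2) :: NSub h h (h + 2) :: Jmp (b + 2) :: nil),
    (len + 6)%nat, K, (a + 7)%nat, (S k).
  split; [intros b; simpl; rewrite length_app, Hlen; simpl; lia|].
  intros g P b N M Hd Hi HK Hr (HN & HI).
  apply installed_cons in Hi as (I0 & Hi). apply installed_cons in Hi as (I1 & Hi).
  apply installed_cons in Hi as (I2 & Hi). simpl in Hi.
  replace (S (S (S b))) with (b + 3)%nat in Hi by lia.
  apply installed_app in Hi as (Hb & Hi). rewrite Hlen in Hi.
  apply installed_cons in Hi as (I3 & Hi). apply installed_cons in Hi as (I4 & Hi).
  apply installed_cons in Hi as (I5 & _).
  (* [j] iterations remain and the loop variable holds [i]; the induction is on [j]. *)
  assert (Loop : forall j i N1 M1, (i + j)%nat = B g ->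
     N1 h = j -> N1 (h + 1)%nat = i -> N1 (h + 2)%nat = 1%nat ->
     frame h r N M N1 M1 -> Inv g i N1 M1 ->
     exists t N' M', runs P (Config (b + 2) N1 M1) t (Config (b + (len + 6)) N' M') /\
       (t <= 1 + j * (a * size_of d (inst_of G g) ^ k + 4))%nat /\
       frame h r N M N' M' /\ Inv g (B g) N' M').
  { induction j as [|j IH]; intros i N1 M1 Hij Hj Hidx Hone Hf HI1.
    - exists 1%nat, N1, M1. split; [|split; [lia|split; [auto|]]].
      + eapply runs_one; [replace (pc _) with (S (S b)) by (simpl; lia); exact I2|].
        simpl. rewrite Hj. reflexivity.
      + replace (B g) with i by lia. auto.
    - destruct (H (g, i) P (b + 3)%nat N1 M1) as (t & N2 & M2 & E & T & F & Q); auto.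
      + simpl. split; [auto|lia].
      + destruct Hf as (Hf & _). rewrite Hf by lia. auto.
      + assert (Hrep : rep d G loc g N1 M1)
          by (eapply rep_frame; [split; [apply Hh|apply Hloc]| |]; eauto).
        destruct Hrep as (R0 & R1 & Rv & Ri). repeat split; auto. simpl.
        intros x Hx. destruct (Nat.eqb_spec x (nvars G)) as [->|Hne].
        * rewrite upd_same. auto.
        * rewrite upd_other by auto. apply Rv. lia.
      + set (N3 := upd (upd N2 (h + 1)%nat (S i)) h j).
        destruct F as (F1 & F2 & F3). simpl in Q.
        destruct (IH (S i) N3 M2) as (t' & N4 & M4 & E' & T' & F' & Q').
        * lia.
        * unfold N3; regs; auto.
        * unfold N3; regs; auto.
        * unfold N3; regs. rewrite F1; auto; lia.
        * apply (frame_trans h r N M N1 M1); auto. repeat split.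
          -- intros x Hx. unfold N3; regs. apply F1; lia.
          -- intros x Hx. apply F2; lia.
          -- intros x Hx. apply F3; lia.
        (* Loop control writes only below [h + 3], where the invariant does not look. *)
        * apply (Hst g (S i) N2); auto. intros x Hx. unfold N3; regs. auto.
        * exists (1 + (t + (1 + (1 + (1 + t')))))%nat, N4, M4.
          split; [|split; [simpl in T; lia|auto]].
          eapply runs_trans.
          { eapply runs_one; [replace (pc _) with (S (S b)) by (simpl; lia); exact I2|].
            simpl. rewrite Hj. simpl. reflexivity. }
          eapply runs_trans.
          { replace (S (b + 2)) with (b + 3)%nat by lia. exact E. }
          eapply runs_trans; [eapply runs_one; [exact I3|simpl; reflexivity]|].
          eapply runs_trans; [eapply runs_one; [exact I4|simpl; reflexivity]|].
          eapply runs_trans; [eapply runs_one; [exact I5|simpl; reflexivity]|].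
          regs. rewrite !F1 by lia. rewrite Hidx, Hone, Hj.
          replace (i + 1)%nat with (S i) by lia. replace (S j - 1)%nat with j by lia.
          exact E'. }
  set (N1 := upd (upd N (h + 1)%nat 0%nat) (h + 2)%nat 1%nat).
  destruct (Loop (B g) 0%nat N1 M) as (t & N' & M' & E & T & F & Q); auto.
  - unfold N1; regs; auto.
  - unfold N1; regs; auto.
  - unfold N1; regs; auto.
  - repeat split. intros x Hx. unfold N1; regs; auto.
  - apply (Hst g 0%nat N); auto. intros x Hx. unfold N1; regs; auto.
  - exists (1 + (1 + t))%nat, N', M'. split; [|split; [|auto]].
    + eapply runs_trans; [eapply runs_one; [exact I0|simpl; reflexivity]|].
      eapply runs_trans; [eapply runs_one; [exact I1|simpl; reflexivity]|].
      replace (S (S b)) with (b + 2)%nat by lia. exact E.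
    + pose proof (poly_loop (size_of d (inst_of G g)) a k (B g) (size_of_pos _ _) (HB g Hd)).
      lia.
Qed.

(** * Computable functions *)

(** Quantifying over all layouts allows a second value to be computed just above a first one that is
    still in use. *)
Definition Ncomp (d : nat) (G : ctx) (E : G -> nat) : Prop :=
  forall loc h r, allocated G loc h ->
    hoare d G loc h r (fun _ _ _ => True) (fun g N _ => N h = E g).

Definition Rcomp (d : nat) (G : ctx) (E : G -> R) : Prop :=
  forall loc h r, allocated G loc h ->
    hoare d G loc h r (fun _ _ _ => True) (fun g _ M => M r = E g).

Lemma Ncomp_ext (d : nat) (G : ctx) (E F : G -> nat) :
  (forall g, dom G g -> E g = F g) -> Ncomp d G E -> Ncomp d G F.
Proof.
  intros H HE loc h r Ha. eapply hoare_conseq; [| |apply HE; auto]; simpl; auto.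
  intros g N M Hd E1. rewrite E1. auto.
Qed.

Lemma Rcomp_ext (d : nat) (G : ctx) (E F : G -> R) :
  (forall g, dom G g -> E g = F g) -> Rcomp d G E -> Rcomp d G F.
Proof.
  intros H HE loc h r Ha. eapply hoare_conseq; [| |apply HE; auto]; simpl; auto.
  intros g N M Hd E1. rewrite E1. auto.
Qed.

Lemma allocated_S (G : ctx) loc h h' : (h <= h')%nat -> allocated G loc h -> allocated G loc h'.
Proof. intros Hh (H1 & H2). split; [lia|]. intros i Hi. specialize (H2 i Hi). lia. Qed.

Lemma allocated_ext (G : ctx) (B : G -> nat) loc h v :
  (v < h)%nat -> allocated G loc h -> allocated (ctx_ext G B) (upd loc (nvars G) v) h.
Proof.
  intros Hv (H1 & H2). split; auto. simpl. intros i Hi.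
  destruct (Nat.eq_dec i (nvars G)) as [->|Hne]; regs; auto. apply H2; lia.
Qed.

Lemma hoare_weaken (d : nat) (G : ctx) (B : G -> nat) loc h r (Pre Post : assertion G) :
  hoare d G loc h r Pre Post ->
  hoare d (ctx_ext G B) loc h r (fun p => Pre (fst p)) (fun p => Post (fst p)).
Proof.
  intros (code & len & K & a & k & Hlen & H).
  exists code, len, K, a, k. split; auto.
  intros [g i] P b N M (Hd & Hi) H2 H3 (R0 & R1 & Rv & Ri) H5. simpl in *.
  apply H; auto. repeat split; auto.
  intros j Hj. rewrite Rv by lia. destruct (Nat.eqb_spec j (nvars G)); [lia|auto].
Qed.

Lemma Ncomp_weaken (d : nat) (G : ctx) (B E : G -> nat) :
  Ncomp d G E -> Ncomp d (ctx_ext G B) (fun p => E (fst p)).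
Proof.
  intros H loc h r (H1 & H2).
  apply (hoare_weaken d G B loc h r (fun _ _ _ => True) (fun g N _ => N h = E g)).
  apply H. split; auto. intros i Hi. apply H2. simpl; lia.
Qed.

Lemma Rcomp_weaken (d : nat) (G : ctx) (B : G -> nat) (E : G -> R) :
  Rcomp d G E -> Rcomp d (ctx_ext G B) (fun p => E (fst p)).
Proof.
  intros H loc h r (H1 & H2).
  apply (hoare_weaken d G B loc h r (fun _ _ _ => True) (fun g _ M => M r = E g)).
  apply H. split; auto. intros i Hi. apply H2. simpl; lia.
Qed.

Lemma Ncomp_const (d : nat) (G : ctx) (k : nat) : Ncomp d G (fun _ => k).
Proof.
  intros loc h r Ha. apply (hoare_instr d G loc h r 0 (NSet h k)).
  intros g p N M Hd HK Hr _. do 2 eexists. split; [reflexivity|].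
  split; [apply frame_upd_N; lia|]. now regs.
Qed.

(** There is no move between N-registers: the target is cleared and the source added to it. *)
Lemma hoare_copy (d : nat) (G : ctx) loc (h r i : nat) (E : G -> nat) :
  allocated G loc h ->
  (forall g N M, dom G g -> rep d G loc g N M -> N i = E g) -> (i < h)%nat ->
  hoare d G loc h r (fun _ _ _ => True) (fun g N _ => N h = E g).
Proof.
  intros Ha HE Hi.
  apply (hoare_seq d G loc h r _ (fun g N _ => N h = 0%nat /\ N i = E g)); auto.
  - apply (hoare_instr d G loc h r 0 (NSet h 0)).
    intros g p N M Hd HK Hr _. do 2 eexists. split; [reflexivity|].
    split; [apply frame_upd_N; lia|]. regs. split; [auto|]. eapply HE; eauto.
  - apply (hoare_instr d G loc h r 0 (NAdd h h i)).
    intros g p N M Hd HK Hr (E1 & E2). do 2 eexists. split; [reflexivity|].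
    split; [apply frame_upd_N; lia|]. regs. rewrite E1, E2. reflexivity.
Qed.

Lemma Ncomp_var (d : nat) (G : ctx) (B : G -> nat) : Ncomp d (ctx_ext G B) (fun p => snd p).
Proof.
  intros loc h r Ha. apply (hoare_copy d _ loc h r (loc (nvars G))); auto.
  - intros [g i] N M Hd (_ & _ & Rv & _). simpl in *. rewrite Rv by lia.
    now rewrite Nat.eqb_refl.
  - apply Ha. simpl; lia.
Qed.

Lemma Ncomp_nc (d : nat) (G : ctx) : Ncomp d G (fun g => nc (inst_of G g)).
Proof.
  intros loc h r Ha. apply (hoare_copy d _ loc h r 0); auto; [|destruct Ha; lia].
  intros g N M Hd (R0 & _). auto.
Qed.

Lemma Ncomp_nv (d : nat) (G : ctx) : Ncomp d G (fun g => nv (inst_of G g)).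
Proof.
  intros loc h r Ha. apply (hoare_copy d _ loc h r 1); auto; [|destruct Ha; lia].
  intros g N M Hd (_ & R1 & _). auto.
Qed.

Lemma hoare_Npair (d : nat) (G : ctx) loc (h r : nat) (E F : G -> nat) :
  allocated G loc h -> Ncomp d G E -> Ncomp d G F ->
  hoare d G loc h r (fun _ _ _ => True) (fun g N _ => N h = E g /\ N (S h) = F g).
Proof.
  intros Ha HE HF.
  apply (hoare_seq d G loc h r _ (fun g N _ => N h = E g)); [auto|apply HE; auto|].
  apply (hoare_le d G loc h r (S h) r); try lia.
  eapply hoare_conseq; [| |apply (hoare_keep d G loc (S h) r (fun _ _ _ => True)
     (fun g N _ => N (S h) = F g)
     (fun g N _ => N h = E g)); [|apply HF; apply (allocated_S G loc h); auto]]; simpl; auto.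
  intros g N M N' M' (F1 & _) H. rewrite F1; auto.
Qed.

Lemma Ncomp_op (d : nat) (G : ctx) (E F : G -> nat) (op : nat -> nat -> nat)
    (ins : nat -> nat -> nat -> instr) :
  (forall i j k s, step (ins i j k) s =
     Config (S (pc s)) (upd (nreg s) i (op (nreg s j) (nreg s k))) (rreg s)) ->
  Ncomp d G E -> Ncomp d G F -> Ncomp d G (fun g => op (E g) (F g)).
Proof.
  intros Hop HE HF loc h r Ha.
  eapply hoare_seq; [auto|apply (hoare_Npair d G loc h r E F); auto|].
  apply (hoare_instr d G loc h r 0 (ins h h (S h))).
  intros g p N M Hd HK Hr (E1 & E2). rewrite Hop; simpl. do 2 eexists. split; [reflexivity|].
  split; [apply frame_upd_N; lia|]. regs. now rewrite E1, E2.
Qed.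

Lemma Ncomp_add (d : nat) (G : ctx) (E F : G -> nat) :
  Ncomp d G E -> Ncomp d G F -> Ncomp d G (fun g => E g + F g)%nat.
Proof. apply (Ncomp_op d G E F Nat.add NAdd). reflexivity. Qed.

Lemma Ncomp_sub (d : nat) (G : ctx) (E F : G -> nat) :
  Ncomp d G E -> Ncomp d G F -> Ncomp d G (fun g => E g - F g)%nat.
Proof. apply (Ncomp_op d G E F Nat.sub NSub). reflexivity. Qed.

Lemma Ncomp_mul_const (d : nat) (G : ctx) (E : G -> nat) (k : nat) :
  Ncomp d G E -> Ncomp d G (fun g => E g * k)%nat.
Proof.
  intros HE. induction k as [|k IH].
  - apply (Ncomp_ext d G (fun _ => 0%nat)); [intros; lia|apply Ncomp_const].
  - apply (Ncomp_ext d G (fun g => E g * k + E g)%nat); [intros; lia|].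
    now apply Ncomp_add.
Qed.

Lemma Rcomp_const (d : nat) (G : ctx) (k : nat) : Rcomp d G (fun _ => INR k).
Proof.
  (* The bound [S r] keeps the scratch register [r] strictly below the copy of the input. *)
  intros loc h r Ha. apply (hoare_instr d G loc h r (S r) (RSet r k)).
  intros g p N M Hd HK Hr _. do 2 eexists. split; [reflexivity|].
  split; [apply frame_upd_R; cbn [nreg rreg pc] in *; lia|]. now regs.
Qed.

Lemma hoare_Rpair (d : nat) (G : ctx) loc (h r : nat) (E F : G -> R) :
  allocated G loc h -> Rcomp d G E -> Rcomp d G F ->
  hoare d G loc h r (fun _ _ _ => True) (fun g _ M => M r = E g /\ M (S r) = F g).
Proof.
  intros Ha HE HF.
  apply (hoare_seq d G loc h r _ (fun g _ M => M r = E g)); [auto|apply HE; auto|].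
  apply (hoare_le d G loc h r h (S r)); try lia.
  eapply hoare_conseq; [| |apply (hoare_keep d G loc h (S r) (fun _ _ _ => True)
     (fun g _ M => M (S r) = F g)
     (fun g _ M => M r = E g)); [|apply HF; auto]]; simpl; auto.
  intros g N M N' M' (_ & F2 & _) H. rewrite F2; auto.
Qed.

Lemma Rcomp_op (d : nat) (G : ctx) (E F : G -> R) (op : R -> R -> R)
    (ins : nat -> nat -> nat -> instr) :
  (forall i j k s, step (ins i j k) s =
     Config (S (pc s)) (nreg s) (upd (rreg s) i (op (rreg s j) (rreg s k)))) ->
  Rcomp d G E -> Rcomp d G F -> Rcomp d G (fun g => op (E g) (F g)).
Proof.
  intros Hop HE HF loc h r Ha.
  eapply hoare_seq; [auto|apply (hoare_Rpair d G loc h r E F); auto|].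
  apply (hoare_instr d G loc h r (S r) (ins r r (S r))).
  intros g p N M Hd HK Hr (E1 & E2). rewrite Hop; simpl. do 2 eexists. split; [reflexivity|].
  split; [apply frame_upd_R; cbn [nreg rreg pc] in *; lia|]. regs. now rewrite E1, E2.
Qed.

Lemma Rcomp_add (d : nat) (G : ctx) (E F : G -> R) :
  Rcomp d G E -> Rcomp d G F -> Rcomp d G (fun g => E g + F g).
Proof. apply (Rcomp_op d G E F Rplus RAdd). reflexivity. Qed.

Lemma Rcomp_sub (d : nat) (G : ctx) (E F : G -> R) :
  Rcomp d G E -> Rcomp d G F -> Rcomp d G (fun g => E g - F g).
Proof. apply (Rcomp_op d G E F Rminus RSub). reflexivity. Qed.

Lemma Rcomp_mul (d : nat) (G : ctx) (E F : G -> R) :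
  Rcomp d G E -> Rcomp d G F -> Rcomp d G (fun g => E g * F g).
Proof. apply (Rcomp_op d G E F Rmult RMul). reflexivity. Qed.

Lemma Rcomp_div (d : nat) (G : ctx) (E F : G -> R) :
  Rcomp d G E -> Rcomp d G F -> Rcomp d G (fun g => E g / F g).
Proof. apply (Rcomp_op d G E F Rdiv RDiv). reflexivity. Qed.

Lemma Rcomp_sqrt (d : nat) (G : ctx) (E : G -> R) :
  Rcomp d G E -> Rcomp d G (fun g => sqrt (E g)).
Proof.
  intros HE loc h r Ha. eapply hoare_seq; [auto|apply HE; auto|].
  apply (hoare_instr d G loc h r (S r) (RSqrt r r)).
  intros g p N M Hd HK Hr E1. do 2 eexists. split; [reflexivity|].
  split; [apply frame_upd_R; cbn [nreg rreg pc] in *; lia|]. regs. now rewrite E1.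
Qed.

Lemma Rcomp_input (d : nat) (G : ctx) (A : G -> nat) :
  (forall g, dom G g -> (A g < mem_size d (inst_of G g))%nat) ->
  Ncomp d G A -> Rcomp d G (fun g => input d (inst_of G g) (A g)).
Proof.
  intros Hlt HA loc h r Ha. eapply hoare_seq; [auto|apply HA; auto|].
  apply (hoare_seq d G loc h r _ (fun g N M => N h = N 2 + A g)%nat); auto.
  - apply (hoare_instr d G loc h r 0 (NAdd h 2 h)).
    intros g p N M Hd HK Hr E1. do 2 eexists. split; [reflexivity|].
    split; [apply frame_upd_N; lia|]. destruct Ha. regs. now rewrite E1.
  - apply (hoare_instr d G loc h r (S r) (RLoad r h)).
    intros g p N M Hd HK Hr E1. do 2 eexists. split; [reflexivity|].
    split; [apply frame_upd_R; cbn [nreg rreg pc] in *; lia|]. regs. rewrite E1. apply Hr. auto.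
Qed.

Lemma Ncomp_Rleb (d : nat) (G : ctx) (E F : G -> R) :
  Rcomp d G E -> Rcomp d G F -> Ncomp d G (fun g => if Rleb (E g) (F g) then 1 else 0)%nat.
Proof.
  intros HE HF loc h r Ha.
  eapply hoare_seq; [auto|apply (hoare_Rpair d G loc h r E F); auto|].
  exists (fun b => NSet h 1 :: RJle r (S r) (b + 3) :: NSet h 0 :: nil), 3%nat, 0%nat,
    3%nat, 0%nat.
  split; [reflexivity|].
  intros g P b N M Hd Hi HK Hr (E1 & E2).
  apply installed_cons in Hi as (I0 & Hi). apply installed_cons in Hi as (I1 & Hi).
  apply installed_cons in Hi as (I2 & _).
  destruct (Rleb (E g) (F g)) eqn:El.
  - exists 2%nat, (upd N h 1%nat), M. split; [|split; [simpl; lia|split]].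
    + apply (runs_trans _ _ (Config (S b) (upd N h 1%nat) M) _ 1 1);
        [eapply runs_one; [exact I0|reflexivity]|].
      eapply runs_one; [exact I1|]. simpl. rewrite E1, E2, El. reflexivity.
    + apply frame_upd_N; lia.
    + now regs.
  - exists 3%nat, (upd (upd N h 1%nat) h 0%nat), M. split; [|split; [simpl; lia|split]].
    + apply (runs_trans _ _ (Config (S b) (upd N h 1%nat) M) _ 1 2);
        [eapply runs_one; [exact I0|reflexivity]|].
      apply (runs_trans _ _ (Config (S (S b)) (upd N h 1%nat) M) _ 1 1).
      * eapply runs_one; [exact I1|]. simpl. rewrite E1, E2, El. reflexivity.
      * eapply runs_one; [exact I2|]. simpl. f_equal. lia.
    + apply (frame_trans h r N M (upd N h 1%nat) M); [apply Ha| |]; apply frame_upd_N; lia.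
    + now regs.
Qed.

Lemma Rcomp_sumV (d : nat) (G : ctx) (B : G -> nat) (E : G -> nat -> R) :
  (forall g, dom G g -> (B g <= size_of d (inst_of G g))%nat) -> Ncomp d G B ->
  Rcomp d (ctx_ext G B) (fun p => E (fst p) (snd p)) ->
  Rcomp d G (fun g => sumV (B g) (E g)).
Proof.
  intros HB HcB HE loc h r Ha.
  apply (hoare_seq d G loc h r _ (fun g N _ => N h = B g)); [auto|apply HcB; auto|].
  apply (hoare_seq d G loc h r _ (fun g N M => N h = B g /\ M r = sumV 0 (E g))); auto.
  - apply (hoare_instr d G loc h r (S r) (RSet r 0)).
    intros g p N M Hd HK Hr E1. do 2 eexists. split; [reflexivity|].
    split; [apply frame_upd_R; cbn [nreg rreg pc] in *; lia|]. now regs.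
  - apply (hoare_for d G loc h r B (fun g i _ M => M r = sumV i (E g))); auto.
    assert (Ha' : allocated (ctx_ext G B) (upd loc (nvars G) (h + 1)%nat) (h + 3)%nat)
      by (apply allocated_ext; [lia|apply (allocated_S G loc h); auto; lia]).
    apply (hoare_seq d (ctx_ext G B) _ _ _ _ (fun p N M => M r = sumV (snd p) (E (fst p)) /\
             M (S r) = E (fst p) (snd p))); auto.
    + apply (hoare_le d (ctx_ext G B) _ (h + 3) r (h + 3) (S r)); try lia.
      eapply hoare_conseq; [| |apply (hoare_keep d (ctx_ext G B) _ (h + 3) (S r) (fun _ _ _ => True)
        (fun p _ M => M (S r) = E (fst p) (snd p))
        (fun p _ M => M r = sumV (snd p) (E (fst p)))); [|apply HE; auto]]; simpl; auto.
      intros g N M N' M' (_ & F2 & _) H. rewrite F2; auto.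
    + apply (hoare_instr d _ _ _ _ (S r) (RAdd r r (S r))).
      intros g p N M Hd HK Hr (E1 & E2). do 2 eexists. split; [reflexivity|].
      split; [apply frame_upd_R; cbn [nreg rreg pc] in *; lia|]. regs. now rewrite E1, E2.
Qed.

(** Loop control occupies [h] to [h + 2], so the accumulator sits in [h + 3] and each term in
    [h + 4]; the result is moved down to [h] afterwards. *)
Lemma Ncomp_sumN (d : nat) (G : ctx) (B : G -> nat) (E : G -> nat -> nat) :
  (forall g, dom G g -> (B g <= size_of d (inst_of G g))%nat) -> Ncomp d G B ->
  Ncomp d (ctx_ext G B) (fun p => E (fst p) (snd p)) ->
  Ncomp d G (fun g => sumN (B g) (E g)).
Proof.
  intros HB HcB HE loc h r Ha.
  apply (hoare_seq d G loc h r _ (fun g N _ => N h = B g)); [auto|apply HcB; auto|].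
  apply (hoare_seq d G loc h r _ (fun g N M => N h = B g /\ N (h + 3)%nat = sumN 0 (E g))); auto.
  { apply (hoare_instr d G loc h r 0 (NSet (h + 3) 0)).
    intros g p N M Hd HK Hr E1. do 2 eexists. split; [reflexivity|].
    split; [apply frame_upd_N; lia|]. now regs. }
  apply (hoare_seq d G loc h r _ (fun g N M => N (h + 3)%nat = sumN (B g) (E g))); auto.
  - apply (hoare_for d G loc h r B (fun g i N _ => N (h + 3)%nat = sumN i (E g))); auto.
    { intros g i N N' _ H E1. rewrite H; auto. }
    assert (Ha' : allocated (ctx_ext G B) (upd loc (nvars G) (h + 1)%nat) (h + 3)%nat)
      by (apply allocated_ext; [lia|apply (allocated_S G loc h); auto; lia]).
    apply (hoare_seq d (ctx_ext G B) _ _ _ _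
             (fun p N M => N (h + 3)%nat = sumN (snd p) (E (fst p)) /\
             N (h + 4)%nat = E (fst p) (snd p))); auto.
    + apply (hoare_le d (ctx_ext G B) _ (h + 3) r (h + 4) r); try lia.
      eapply hoare_conseq; [| |apply (hoare_keep d (ctx_ext G B) _ (h + 4) r (fun _ _ _ => True)
        (fun p N _ => N (h + 4)%nat = E (fst p) (snd p))
        (fun p N _ => N (h + 3)%nat = sumN (snd p) (E (fst p))));
        [|apply HE; apply (allocated_S _ _ (h + 3)); auto; lia]]; simpl; auto.
      intros g N M N' M' (F1 & _) H. rewrite F1; auto; lia.
    + apply (hoare_instr d _ _ _ _ 0 (NAdd (h + 3) (h + 3) (h + 4))).
      intros g p N M Hd HK Hr (E1 & E2). do 2 eexists. split; [reflexivity|].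
      split; [apply frame_upd_N; lia|]. regs. now rewrite E1, E2.
  - apply (hoare_seq d G loc h r _ (fun g N M => N (h + 3)%nat = sumN (B g) (E g) /\
      N h = 0%nat)); auto.
    + apply (hoare_instr d _ _ _ _ 0 (NSet h 0)).
      intros g p N M Hd HK Hr E1. do 2 eexists. split; [reflexivity|].
      split; [apply frame_upd_N; lia|]. regs. auto.
    + apply (hoare_instr d _ _ _ _ 0 (NAdd h h (h + 3))).
      intros g p N M Hd HK Hr (E1 & E2). do 2 eexists. split; [reflexivity|].
      split; [apply frame_upd_N; lia|]. regs. now rewrite E1, E2.
Qed.

(** * Computable booleans and vectors *)

Definition Bcomp (d : nat) (G : ctx) (b : G -> bool) : Prop :=
  Ncomp d G (fun g => if b g then 1 else 0)%nat.

(** Vectors are never stored: each coordinate has its own fragment and is recomputed on demand. As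
    [d] is fixed, the code length remains constant. *)
Definition Vcomp (d : nat) (G : ctx) (x : G -> nat -> R) : Prop :=
  forall t, (t < d)%nat -> Rcomp d G (fun g => x g t).

Lemma Bcomp_negb (d : nat) (G : ctx) (b : G -> bool) :
  Bcomp d G b -> Bcomp d G (fun g => negb (b g)).
Proof.
  intros H. apply (Ncomp_ext d G (fun g => 1 - if b g then 1 else 0)%nat).
  - intros g _. destruct (b g); reflexivity.
  - apply Ncomp_sub; [apply Ncomp_const|exact H].
Qed.

(** With truncated subtraction, b + c - 1 is the conjunction of two bits. *)
Lemma Bcomp_andb (d : nat) (G : ctx) (b c : G -> bool) :
  Bcomp d G b -> Bcomp d G c -> Bcomp d G (fun g => b g && c g).
Proof.
  intros Hb Hc.
  apply (Ncomp_ext d G (fun g => (if b g then 1 else 0) + (if c g then 1 else 0) - 1)%nat).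
  - intros g _. destruct (b g), (c g); reflexivity.
  - apply Ncomp_sub; [apply Ncomp_add; auto|apply Ncomp_const].
Qed.

Lemma Bcomp_eqb (d : nat) (G : ctx) (E F : G -> nat) :
  Ncomp d G E -> Ncomp d G F -> Bcomp d G (fun g => Nat.eqb (E g) (F g)).
Proof.
  intros HE HF. apply (Ncomp_ext d G (fun g => 1 - ((E g - F g) + (F g - E g)))%nat).
  - intros g _. destruct (Nat.eqb_spec (E g) (F g)); lia.
  - apply Ncomp_sub; [apply Ncomp_const|apply Ncomp_add; apply Ncomp_sub; auto].
Qed.

Lemma Bcomp_Rleb (d : nat) (G : ctx) (E F : G -> R) :
  Rcomp d G E -> Rcomp d G F -> Bcomp d G (fun g => Rleb (E g) (F g)).
Proof. apply Ncomp_Rleb. Qed.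

Lemma Rltb_negb (a b : R) : Rltb a b = negb (Rleb b a).
Proof. unfold Rltb, Rleb. destruct (Rlt_dec a b), (Rle_dec b a); simpl; auto; lra. Qed.

Lemma Bcomp_Rltb (d : nat) (G : ctx) (E F : G -> R) :
  Rcomp d G E -> Rcomp d G F -> Bcomp d G (fun g => Rltb (E g) (F g)).
Proof.
  intros HE HF. apply (Ncomp_ext d G (fun g => if negb (Rleb (F g) (E g)) then 1 else 0)%nat).
  - intros g _. now rewrite Rltb_negb.
  - apply Bcomp_negb, Bcomp_Rleb; auto.
Qed.

Lemma countN_sumN (n : nat) (P : nat -> bool) :
  countN n P = sumN n (fun i => if P i then 1 else 0)%nat.
Proof. induction n as [|n IH]; simpl; auto. Qed.

Lemma Ncomp_countN (d : nat) (G : ctx) (B : G -> nat) (P : G -> nat -> bool) :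
  (forall g, dom G g -> (B g <= size_of d (inst_of G g))%nat) -> Ncomp d G B ->
  Bcomp d (ctx_ext G B) (fun p => P (fst p) (snd p)) ->
  Ncomp d G (fun g => countN (B g) (P g)).
Proof.
  intros HB HcB HP.
  apply (Ncomp_ext d G (fun g => sumN (B g) (fun i => if P g i then 1 else 0)%nat)).
  - intros g _. now rewrite countN_sumN.
  - apply Ncomp_sumN; auto.
Qed.

(** A sum of constant length is unrolled in the code, so each index may have a fragment of its
    own. *)
Lemma Ncomp_sumN_const (d : nat) (G : ctx) (D : nat) (E : G -> nat -> nat) :
  (forall i, (i < D)%nat -> Ncomp d G (fun g => E g i)) ->
  Ncomp d G (fun g => sumN D (E g)).
Proof.
  induction D as [|D IH]; intros H; simpl; [apply Ncomp_const|].
  apply Ncomp_add; auto.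
Qed.

Lemma Rcomp_sumR (d : nat) (G : ctx) (D : nat) (E : G -> nat -> R) :
  (forall t, (t < D)%nat -> Rcomp d G (fun g => E g t)) ->
  Rcomp d G (fun g => sumR D (E g)).
Proof.
  induction D as [|D IH]; intros H; simpl; [apply (Rcomp_const d G 0)|].
  apply Rcomp_add; auto.
Qed.

Lemma Rcomp_opp (d : nat) (G : ctx) (E : G -> R) :
  Rcomp d G E -> Rcomp d G (fun g => - E g).
Proof.
  intros H. apply (Rcomp_ext d G (fun g => INR 0 - E g)).
  - intros; simpl; ring.
  - apply Rcomp_sub; [apply Rcomp_const|auto].
Qed.

Lemma Vcomp_weaken (d : nat) (G : ctx) (B : G -> nat) (x : G -> nat -> R) :
  Vcomp d G x -> Vcomp d (ctx_ext G B) (fun p => x (fst p)).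
Proof. intros H t Ht. apply (Rcomp_weaken d G B (fun g => x g t)). auto. Qed.

Lemma Rcomp_sqd (d : nat) (G : ctx) (x y : G -> nat -> R) :
  Vcomp d G x -> Vcomp d G y -> Rcomp d G (fun g => sqd d (x g) (y g)).
Proof.
  intros Hx Hy. apply Rcomp_sumR. intros t Ht.
  apply (Rcomp_ext d G (fun g => (x g t - y g t) * (x g t - y g t))); [intros; ring|].
  apply Rcomp_mul; apply Rcomp_sub; auto.
Qed.

Lemma Rcomp_dist (d : nat) (G : ctx) (x y : G -> nat -> R) :
  Vcomp d G x -> Vcomp d G y -> Rcomp d G (fun g => dist d (x g) (y g)).
Proof.
  intros Hx Hy. apply (Rcomp_sqrt d G (fun g => sqd d (x g) (y g))).
  now apply Rcomp_sqd.
Qed.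

Lemma Rcomp_dot (d : nat) (G : ctx) (x y : G -> nat -> R) :
  Vcomp d G x -> Vcomp d G y -> Rcomp d G (fun g => dot d (x g) (y g)).
Proof. intros Hx Hy. apply Rcomp_sumR. intros t Ht. apply Rcomp_mul; auto. Qed.

(** * Reading the input *)

Lemma input_bound (d : nat) (I : inst) : input d I 0 = bound I.
Proof. reflexivity. Qed.

Lemma input_rule (d : nat) (I : inst) (a : nat) :
  (1 <= a <= nc I)%nat -> input d I a = rule I a.
Proof.
  intros H. unfold input, start_config, init_config; simpl.
  destruct (Nat.eqb_spec a 0); [lia|]. destruct (Nat.leb_spec a (nc I)); [auto|lia].
Qed.

Lemma div_mod_pair (d i t : nat) :
  (t < d)%nat -> ((i * d + t) / d = i /\ (i * d + t) mod d = t)%nat.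
Proof.
  intros Ht. split.
  - rewrite Nat.add_comm, Nat.div_add by lia. rewrite Nat.div_small by lia. lia.
  - rewrite Nat.add_comm, Nat.Div0.mod_add. now apply Nat.mod_small.
Qed.

Lemma input_cand (d : nat) (I : inst) (i t : nat) :
  (i < nc I)%nat -> (t < d)%nat -> input d I (1 + nc I + (i * d + t)) = cand_at I i t.
Proof.
  intros Hi Ht. unfold input, start_config, init_config; cbn [rreg].
  assert (i * d + t < nc I * d)%nat by nia.
  destruct (Nat.eqb_spec (1 + nc I + (i * d + t)) 0); [lia|].
  destruct (Nat.leb_spec (1 + nc I + (i * d + t)) (nc I)); [lia|].
  destruct (Nat.ltb_spec (1 + nc I + (i * d + t)) (1 + nc I + nc I * d)); [|lia].
  replace (1 + nc I + (i * d + t) - 1 - nc I)%nat with (i * d + t)%nat by lia.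
  destruct (div_mod_pair d i t Ht) as (-> & ->). reflexivity.
Qed.

Lemma input_voter (d : nat) (I : inst) (k t : nat) :
  (k < nv I)%nat -> (t < d)%nat ->
  input d I (1 + nc I + nc I * d + (k * d + t)) = voter_at I k t.
Proof.
  intros Hk Ht. unfold input, start_config, init_config; cbn [rreg].
  assert (k * d + t < nv I * d)%nat by nia.
  destruct (Nat.eqb_spec (1 + nc I + nc I * d + (k * d + t)) 0); [lia|].
  destruct (Nat.leb_spec (1 + nc I + nc I * d + (k * d + t)) (nc I)); [lia|].
  destruct (Nat.ltb_spec (1 + nc I + nc I * d + (k * d + t)) (1 + nc I + nc I * d)); [lia|].
  destruct (Nat.ltb_spec (1 + nc I + nc I * d + (k * d + t))
              (1 + nc I + nc I * d + nv I * d)); [|lia].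
  replace (1 + nc I + nc I * d + (k * d + t) - 1 - nc I - nc I * d)%nat
    with (k * d + t)%nat by lia.
  destruct (div_mod_pair d k t Ht) as (-> & ->). reflexivity.
Qed.

Lemma Rcomp_bound (d : nat) (G : ctx) : Rcomp d G (fun g => bound (inst_of G g)).
Proof.
  apply (Rcomp_ext d G (fun g => input d (inst_of G g) 0)); [intros; apply input_bound|].
  apply Rcomp_input; [intros; unfold mem_size; lia|apply Ncomp_const].
Qed.

Lemma Rcomp_rule (d : nat) (G : ctx) (A : G -> nat) :
  (forall g, dom G g -> (1 <= A g <= nc (inst_of G g))%nat) -> Ncomp d G A ->
  Rcomp d G (fun g => rule (inst_of G g) (A g)).
Proof.
  intros HA HcA. apply (Rcomp_ext d G (fun g => input d (inst_of G g) (A g))).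
  - intros g Hd. apply input_rule; auto.
  - apply Rcomp_input; auto. intros g Hd. specialize (HA g Hd). unfold mem_size. lia.
Qed.

Lemma Vcomp_cand_at (d : nat) (G : ctx) (A : G -> nat) :
  (forall g, dom G g -> (A g < nc (inst_of G g))%nat) -> Ncomp d G A ->
  Vcomp d G (fun g => cand_at (inst_of G g) (A g)).
Proof.
  intros HA HcA t Ht.
  apply (Rcomp_ext d G (fun g => input d (inst_of G g)
           (1 + nc (inst_of G g) + (A g * d + t)))).
  - intros g Hd. apply input_cand; auto.
  - apply Rcomp_input.
    + intros g Hd. specialize (HA g Hd). unfold mem_size.
      assert (A g * d + t < nc (inst_of G g) * d)%nat by nia. lia.
    + repeat apply Ncomp_add; try apply Ncomp_const; [apply Ncomp_nc|].
      now apply Ncomp_mul_const.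
Qed.

Lemma Vcomp_voter_at (d : nat) (G : ctx) (A : G -> nat) :
  (forall g, dom G g -> (A g < nv (inst_of G g))%nat) -> Ncomp d G A ->
  Vcomp d G (fun g => voter_at (inst_of G g) (A g)).
Proof.
  intros HA HcA t Ht.
  apply (Rcomp_ext d G (fun g => input d (inst_of G g)
           (1 + nc (inst_of G g) + nc (inst_of G g) * d + (A g * d + t)))).
  - intros g Hd. apply input_voter; auto.
  - apply Rcomp_input.
    + intros g Hd. specialize (HA g Hd). unfold mem_size.
      assert (A g * d + t < nv (inst_of G g) * d)%nat by nia. lia.
    + repeat apply Ncomp_add; try apply Ncomp_const.
      * apply Ncomp_nc.
      * apply (Ncomp_mul_const d G (fun g => nc (inst_of G g))), Ncomp_nc.
      * now apply Ncomp_mul_const.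
Qed.

Lemma nc_le_size (d : nat) (I : inst) : (nc I <= size_of d I)%nat.
Proof. unfold size_of, input_size. lia. Qed.

(* In dimension 0 the voters take no room in the input. *)
Lemma nv_le_size (d : nat) (I : inst) : (1 <= d)%nat -> (nv I <= size_of d I)%nat.
Proof. unfold size_of, input_size. nia. Qed.

(** Ensures that candidate 0 can be read and that the rank of the target lies in the range of the
    rule. *)
Definition nonempty (G : ctx) : Prop := forall g, dom G g -> (1 <= nc (inst_of G g))%nat.

Lemma nonempty_ext (G : ctx) (B : G -> nat) : nonempty G -> nonempty (ctx_ext G B).
Proof. intros H [g i] (Hd & _). now apply H. Qed.

(** * Computing ranks, scores and tests *)

Lemma Ncomp_rank_target (d : nat) (G : ctx) (x w : G -> nat -> R) :
  Vcomp d G x -> Vcomp d G w ->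
  Ncomp d G (fun g => rank_target d (nc (inst_of G g)) (cand_at (inst_of G g)) (x g) (w g)).
Proof.
  intros Hx Hw. unfold rank_target.
  apply (Ncomp_add d G (fun _ => 1%nat)); [apply Ncomp_const|].
  apply (Ncomp_countN d G (fun g => nc (inst_of G g)) (fun g j => negb (Nat.eqb j 0) &&
    Rleb (dist d (w g) (cand_at (inst_of G g) j)) (dist d (w g) (x g)))).
  - intros; apply nc_le_size.
  - apply Ncomp_nc.
  - set (H := ctx_ext G (fun g => nc (inst_of G g))).
    apply (Bcomp_andb d H).
    + apply Bcomp_negb, (Bcomp_eqb d H (fun p => snd p) (fun _ => 0%nat));
        [apply Ncomp_var|apply Ncomp_const].
    + apply (Bcomp_Rleb d H); apply (Rcomp_dist d H).
      * now apply Vcomp_weaken.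
      * apply (Vcomp_cand_at d H (fun p => snd p)); [intros p Hp; apply Hp|apply Ncomp_var].
      * now apply Vcomp_weaken.
      * now apply Vcomp_weaken.
Qed.

Lemma Ncomp_rank_other (d : nat) (G : ctx) (x w : G -> nat -> R) (J : G -> nat) :
  Vcomp d G x -> Vcomp d G w -> Ncomp d G J ->
  (forall g, dom G g -> (J g < nc (inst_of G g))%nat) ->
  Ncomp d G (fun g => rank_other d (nc (inst_of G g)) (cand_at (inst_of G g)) (x g) (w g) (J g)).
Proof.
  intros Hx Hw HJ HJn. unfold rank_other.
  apply (Ncomp_add d G (fun _ => 1%nat)); [apply Ncomp_const|].
  apply Ncomp_add.
  - apply (Ncomp_countN d G (fun g => nc (inst_of G g)) (fun g l => negb (Nat.eqb l 0) &&
      negb (Nat.eqb l (J g)) &&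
      Rltb (dist d (w g) (cand_at (inst_of G g) l))
           (dist d (w g) (cand_at (inst_of G g) (J g))))).
    + intros; apply nc_le_size.
    + apply Ncomp_nc.
    + set (H := ctx_ext G (fun g => nc (inst_of G g))).
      apply (Bcomp_andb d H); [apply (Bcomp_andb d H)|].
      * apply Bcomp_negb, (Bcomp_eqb d H (fun p => snd p) (fun _ => 0%nat));
          [apply Ncomp_var|apply Ncomp_const].
      * apply Bcomp_negb, (Bcomp_eqb d H (fun p => snd p) (fun p => J (fst p)));
          [apply Ncomp_var|now apply Ncomp_weaken].
      * apply (Bcomp_Rltb d H); apply (Rcomp_dist d H).
        -- now apply Vcomp_weaken.
        -- apply (Vcomp_cand_at d H (fun p => snd p)); [intros p Hp; apply Hp|apply Ncomp_var].
        -- now apply Vcomp_weaken.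
        -- apply (Vcomp_weaken d G _ (fun g => cand_at (inst_of G g) (J g))).
           now apply Vcomp_cand_at.
  - apply (Bcomp_Rltb d G); apply Rcomp_dist; auto. now apply Vcomp_cand_at.
Qed.

Lemma Rcomp_score_target (d : nat) (G : ctx) (x : G -> nat -> R) :
  (0 < d)%nat -> nonempty G -> Vcomp d G x ->
  Rcomp d G (fun g => score_target d (nc (inst_of G g)) (nv (inst_of G g))
    (cand_at (inst_of G g)) (voter_at (inst_of G g)) (rule (inst_of G g)) (x g)).
Proof.
  intros Hd Hn Hx.
  apply (Rcomp_sumV d G (fun g => nv (inst_of G g)) (fun g k => rule (inst_of G g)
    (rank_target d (nc (inst_of G g)) (cand_at (inst_of G g)) (x g)
       (voter_at (inst_of G g) k)))).
  - intros; now apply nv_le_size.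
  - apply Ncomp_nv.
  - set (H := ctx_ext G (fun g => nv (inst_of G g))).
    apply (Rcomp_rule d H (fun p => rank_target d (nc (inst_of H p)) (cand_at (inst_of H p))
      (x (fst p)) (voter_at (inst_of H p) (snd p)))).
    + intros p Hp. split; [unfold rank_target; lia|].
      apply rank_target_le. now apply (nonempty_ext G).
    + apply (Ncomp_rank_target d H (fun p => x (fst p))
        (fun p => voter_at (inst_of H p) (snd p))); [now apply Vcomp_weaken|].
      apply (Vcomp_voter_at d H (fun p => snd p)); [intros p Hp; apply Hp|apply Ncomp_var].
Qed.

Lemma Rcomp_score_other (d : nat) (G : ctx) (x : G -> nat -> R) (J : G -> nat) :
  (0 < d)%nat -> Vcomp d G x -> Ncomp d G J ->
  (forall g, dom G g -> (1 <= J g < nc (inst_of G g))%nat) ->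
  Rcomp d G (fun g => score_other d (nc (inst_of G g)) (nv (inst_of G g))
    (cand_at (inst_of G g)) (voter_at (inst_of G g)) (rule (inst_of G g)) (x g) (J g)).
Proof.
  intros Hd Hx HJ HJn.
  apply (Rcomp_sumV d G (fun g => nv (inst_of G g)) (fun g k => rule (inst_of G g)
    (rank_other d (nc (inst_of G g)) (cand_at (inst_of G g)) (x g)
       (voter_at (inst_of G g) k) (J g)))).
  - intros; now apply nv_le_size.
  - apply Ncomp_nv.
  - set (H := ctx_ext G (fun g => nv (inst_of G g))).
    apply (Rcomp_rule d H (fun p => rank_other d (nc (inst_of H p)) (cand_at (inst_of H p))
      (x (fst p)) (voter_at (inst_of H p) (snd p)) (J (fst p)))).
    + intros p Hp. split; [unfold rank_other; lia|].
      apply rank_other_le. apply HJn, Hp.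
    + apply (Ncomp_rank_other d H (fun p => x (fst p))
        (fun p => voter_at (inst_of H p) (snd p)) (fun p => J (fst p))).
      * now apply Vcomp_weaken.
      * apply (Vcomp_voter_at d H (fun p => snd p)); [intros p Hp; apply Hp|apply Ncomp_var].
      * now apply Ncomp_weaken.
      * intros p Hp. apply HJn, Hp.
Qed.

Lemma Ncomp_test (d : nat) (G : ctx) (x : G -> nat -> R) :
  (0 < d)%nat -> nonempty G -> Vcomp d G x -> Ncomp d G (fun g => test d (inst_of G g) (x g)).
Proof.
  intros Hd Hn Hx.
  apply (Ncomp_countN d G (fun g => nc (inst_of G g) - 1)%nat (fun g j =>
    Rleb (dist d (x g) (cand_at (inst_of G g) 0)) (bound (inst_of G g)) &&
    Rleb (score_target d (nc (inst_of G g)) (nv (inst_of G g)) (cand_at (inst_of G g))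
            (voter_at (inst_of G g)) (rule (inst_of G g)) (x g))
         (score_other d (nc (inst_of G g)) (nv (inst_of G g)) (cand_at (inst_of G g))
            (voter_at (inst_of G g)) (rule (inst_of G g)) (x g) (S j)))).
  - intros g _. pose proof (nc_le_size d (inst_of G g)). lia.
  - apply Ncomp_sub; [apply Ncomp_nc|apply Ncomp_const].
  - set (H := ctx_ext G (fun g => nc (inst_of G g) - 1)%nat).
    assert (HnH : nonempty H) by now apply nonempty_ext.
    assert (HxH : Vcomp d H (fun p => x (fst p))) by now apply Vcomp_weaken.
    apply (Bcomp_andb d H); apply (Bcomp_Rleb d H).
    + apply (Rcomp_dist d H); auto.
      apply (Vcomp_cand_at d H (fun _ => 0%nat)); [intros p Hp; now apply HnH|apply Ncomp_const].
    + apply (Rcomp_bound d H).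
    + now apply (Rcomp_score_target d H).
    + apply (Rcomp_score_other d H _ (fun p => S (snd p))); auto.
      * apply (Ncomp_add d H (fun _ => 1%nat)); [apply Ncomp_const|apply Ncomp_var].
      * intros [g j] (_ & Hj). simpl in *. lia.
Qed.

(** * Computing the states and the search *)

(** The number of normals must not depend on the input, since Gram-Schmidt is unrolled in the code;
    hence one list [us] of computable vectors serving all [g]. *)
Definition Scomp (d : nat) (G : ctx) (st : G -> state) : Prop :=
  Vcomp d G (fun g => ctr (st g)) /\ Rcomp d G (fun g => rad2 (st g)) /\
  Vcomp d G (fun g => off (st g)) /\
  exists us : list (G -> nat -> R), Forall (Vcomp d G) us /\
    forall g, dirs (st g) = map (fun u => u g) us.

Lemma Vcomp_residual (d : nat) (G : ctx) (st : G -> state) (b : G -> nat -> R) :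
  Scomp d G st -> Vcomp d G b -> Vcomp d G (fun g => residual d (dirs (st g)) (b g)).
Proof.
  intros (_ & _ & _ & us & Hus & E) Hb t Ht.
  apply (Rcomp_ext d G (fun g => residual d (map (fun u => u g) us) (b g) t));
    [intros; now rewrite E|].
  clear E. induction Hus as [|u us Hu _ IH]; simpl; [now apply Hb|].
  apply Rcomp_sub; [auto|]. apply Rcomp_mul; [|now apply Hu].
  now apply Rcomp_dot.
Qed.

Lemma Rcomp_residual_norm (d : nat) (G : ctx) (st : G -> state) (b : G -> nat -> R) :
  Scomp d G st -> Vcomp d G b -> Rcomp d G (fun g =>
    sqrt (dot d (residual d (dirs (st g)) (b g)) (residual d (dirs (st g)) (b g)))).
Proof.
  intros Hs Hb. apply Rcomp_sqrt, Rcomp_dot; now apply Vcomp_residual.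
Qed.

Lemma Vcomp_unit_dir (d : nat) (G : ctx) (st : G -> state) (b : G -> nat -> R) :
  Scomp d G st -> Vcomp d G b -> Vcomp d G (fun g => unit_dir d (dirs (st g)) (b g)).
Proof.
  intros Hs Hb t Ht. apply Rcomp_div.
  - now apply (Vcomp_residual d G st b).
  - now apply Rcomp_residual_norm.
Qed.

Lemma Vcomp_cand (d : nat) (G : ctx) (st : G -> state) (h : G -> R) (i : nat) :
  Scomp d G st -> Rcomp d G h -> Vcomp d G (fun g => cand d (st g) (h g) i).
Proof.
  intros Hs Hh t Ht. pose proof Hs as (Hc & _ & Ho & _).
  apply Rcomp_add; [apply Rcomp_add; [now apply Hc|now apply Ho]|].
  apply Rcomp_mul; [auto|].
  apply (Vcomp_unit_dir d G st (fun _ => basis i)); auto.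
  intros t' Ht'. unfold basis. destruct (Nat.eqb t' i).
  - apply (Rcomp_const d G 1).
  - apply (Rcomp_const d G 0).
Qed.

Lemma Rcomp_radius (d : nat) (G : ctx) (st : G -> state) :
  Scomp d G st -> Rcomp d G (fun g => radius d (st g)).
Proof.
  intros (_ & Hr & Ho & _). apply Rcomp_sqrt, Rcomp_sub; auto. now apply Rcomp_dot.
Qed.

Lemma Scomp_start (d : nat) (G : ctx) (a : G -> nat -> R) (r : G -> R) :
  Vcomp d G a -> Rcomp d G r -> Scomp d G (fun g => start (a g) (r g)).
Proof.
  intros Ha Hr. repeat split; auto.
  - intros t Ht. apply (Rcomp_const d G 0).
  - exists nil. split; auto.
Qed.

Lemma Scomp_extend (d : nat) (G : ctx) (st : G -> state) (a : G -> nat -> R) (r : G -> R) :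
  Scomp d G st -> Vcomp d G a -> Rcomp d G r ->
  Scomp d G (fun g => extend d (st g) (a g) (r g)).
Proof.
  intros Hs Ha Hr. pose proof Hs as (Hc & Hrad & Ho & us & Hus & E).
  assert (Hb : Vcomp d G (fun g t => a g t - ctr (st g) t))
    by (intros t Ht; apply Rcomp_sub; [now apply Ha|now apply Hc]).
  assert (Hu : Vcomp d G (fun g => unit_dir d (dirs (st g)) (fun t => a g t - ctr (st g) t)))
    by now apply (Vcomp_unit_dir d G st (fun g t => a g t - ctr (st g) t)).
  unfold extend. repeat split; simpl; auto.
  - intros t Ht. apply Rcomp_add; [now apply Ho|].
    apply Rcomp_mul; [|now apply Hu].
    apply Rcomp_div;
      [|now apply (Rcomp_residual_norm d G st (fun g t => a g t - ctr (st g) t))].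
    apply Rcomp_sub; [apply Rcomp_div; [apply Rcomp_add; [now apply Rcomp_sub|]|]|].
    + now apply (Rcomp_dot d G (fun g t => a g t - ctr (st g) t)
                   (fun g t => a g t - ctr (st g) t)).
    + apply (Rcomp_const d G 2).
    + now apply (Rcomp_dot d G (fun g t => a g t - ctr (st g) t) (fun g => off (st g))).
  - exists ((fun g => unit_dir d (dirs (st g)) (fun t => a g t - ctr (st g) t)) :: us).
    split; [now constructor|]. intros g. simpl. now rewrite E.
Qed.

Lemma Scomp_weaken (d : nat) (G : ctx) (B : G -> nat) (st : G -> state) :
  Scomp d G st -> Scomp d (ctx_ext G B) (fun p => st (fst p)).
Proof.
  intros (Hc & Hr & Ho & us & Hus & E). repeat split.
  - now apply (Vcomp_weaken d G B (fun g => ctr (st g))).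
  - now apply (Rcomp_weaken d G B (fun g => rad2 (st g))).
  - now apply (Vcomp_weaken d G B (fun g => off (st g))).
  - exists (map (fun u => (fun p : ctx_ext G B => u (fst p))) us). split.
    + apply Forall_map. revert Hus. apply Forall_impl. intros u. apply Vcomp_weaken.
    + intros p. rewrite E, map_map. reflexivity.
Qed.

Lemma Ncomp_test_state (d : nat) (G : ctx) (st : G -> state) :
  (0 < d)%nat -> nonempty G -> Scomp d G st ->
  Ncomp d G (fun g => test_state d (inst_of G g) (st g)).
Proof.
  intros Hd Hn Hs. apply Ncomp_add.
  - apply (Ncomp_test d G (fun g => cand d (st g) 0 0)); auto.
    apply (Vcomp_cand d G st (fun _ => 0)); auto. apply (Rcomp_const d G 0).
  - apply Ncomp_sumN_const. intros i Hi.
    pose proof (Rcomp_radius d G st Hs) as Hr.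
    apply Ncomp_add; apply Ncomp_test; auto; apply Vcomp_cand; auto.
    now apply Rcomp_opp.
Qed.

(** [F] is evaluated under two loop variables, so its computability is demanded in every context [H]
    lying over [G] to which computable states transfer. This generality is what lets the search
    nest. *)
Lemma Ncomp_over_spheres (d : nat) (G : ctx) (F : G -> (nat -> R) -> R -> nat) :
  (0 < d)%nat -> nonempty G ->
  (forall (H : ctx) (up : H -> G) (a : H -> nat -> R) (r : H -> R),
     (forall st, Scomp d G st -> Scomp d H (fun p => st (up p))) ->
     (forall p, inst_of G (up p) = inst_of H p) -> nonempty H ->
     Vcomp d H a -> Rcomp d H r -> Ncomp d H (fun p => F (up p) (a p) (r p))) ->
  Ncomp d G (fun g => over_spheres d (inst_of G g) (F g)).
Proof.
  intros Hd Hn HF. apply Ncomp_add.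
  - apply (HF G (fun g => g)); auto.
    + apply (Vcomp_cand_at d G (fun _ => 0%nat)); [auto|apply Ncomp_const].
    + apply Rcomp_mul; apply Rcomp_bound.
  - apply (Ncomp_sumN d G (fun g => nv (inst_of G g)) (fun g k =>
      sumN (nc (inst_of G g)) (fun l => F g (voter_at (inst_of G g) k)
        (sqd d (voter_at (inst_of G g) k) (cand_at (inst_of G g) l))))).
    + intros; now apply nv_le_size.
    + apply Ncomp_nv.
    + set (H := ctx_ext G (fun g => nv (inst_of G g))).
      apply (Ncomp_sumN d H (fun p => nc (inst_of H p)) (fun p l =>
        F (fst p) (voter_at (inst_of H p) (snd p))
        (sqd d (voter_at (inst_of H p) (snd p)) (cand_at (inst_of H p) l)))).
      * intros; apply nc_le_size.
      * apply (Ncomp_nc d H).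
      * set (K := ctx_ext H (fun p => nc (inst_of H p))).
        assert (Hv : Vcomp d K (fun q => voter_at (inst_of K q) (snd (fst q)))).
        { apply (Vcomp_weaken d H _ (fun p => voter_at (inst_of H p) (snd p))).
          apply (Vcomp_voter_at d H (fun p => snd p)); [intros p Hp; apply Hp|apply Ncomp_var]. }
        apply (HF K (fun q => fst (fst q)) (fun q => voter_at (inst_of K q) (snd (fst q)))
          (fun q => sqd d (voter_at (inst_of K q) (snd (fst q)))
                      (cand_at (inst_of K q) (snd q)))); auto.
        -- intros st Hs. apply (Scomp_weaken d H _ (fun p => st (fst p))).
           now apply Scomp_weaken.
        -- now apply nonempty_ext, nonempty_ext.
        -- apply (Rcomp_sqd d K); auto.
           apply (Vcomp_cand_at d K (fun q => snd q)); [intros q Hq; apply Hq|apply Ncomp_var].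
Qed.

(** The recursion on [L] is unrolled into nested loops, two for each level. The exponent of the
    running time grows with [L], but [L] does not depend on the instance. *)
Lemma Ncomp_search (d : nat) (L : nat) (G : ctx) (st : G -> state) :
  (0 < d)%nat -> nonempty G -> Scomp d G st ->
  Ncomp d G (fun g => search d (inst_of G g) L (st g)).
Proof.
  intros Hd. revert G st. induction L as [|L IH]; intros G st Hn Hs; simpl.
  - now apply Ncomp_test_state.
  - apply Ncomp_add; [now apply Ncomp_test_state|].
    apply (Ncomp_over_spheres d G (fun g a r =>
      search d (inst_of G g) L (extend d (st g) a r))); auto.
    intros H up a r Hup Hi HnH Ha Hr.
    apply (Ncomp_ext d H (fun p => search d (inst_of H p) L (extend d (st (up p)) (a p) (r p)))).
    + intros p _. now rewrite Hi.
    + apply IH; auto. apply Scomp_extend; auto.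
Qed.

Lemma Ncomp_solve (d : nat) (G : ctx) :
  (0 < d)%nat -> nonempty G -> Ncomp d G (fun g => solve d (inst_of G g)).
Proof.
  intros Hd Hn.
  apply (Ncomp_over_spheres d G (fun g a r => search d (inst_of G g) d (start a r))); auto.
  intros H up a r Hup Hi HnH Ha Hr.
  apply (Ncomp_ext d H (fun p => search d (inst_of H p) d (start (a p) (r p)))).
  - intros p _. now rewrite Hi.
  - apply Ncomp_search; auto. now apply Scomp_start.
Qed.

(** * The program *)

(* The scratch registers overlap the input, so the input is moved up by [K],
   from the top down and through R[0]; the content of R[0] is parked behind the
   copy meanwhile.  N[3] is the number of real inputs. *)
Definition prologue (d K : nat) : list instr :=
  (NSet 3 1 :: NAdd 3 3 0 :: nil) ++ repeat (NAdd 3 3 0) d ++ repeat (NAdd 3 3 1) d ++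
  (NSet 2 K :: NAdd 4 3 2 :: RStore 4 0 :: NSet 6 1 :: NSub 5 3 6 ::
   NJz 5 (2 + d + d + 11) :: RLoad 0 5 :: NAdd 7 5 2 :: RStore 7 0 :: NSub 5 5 6 ::
   Jmp (2 + d + d + 5) ::
   RLoad 0 4 :: RStore 2 0 :: nil).

(** Repeated addition replaces multiplication by the constant [d], as the machine cannot multiply
    naturals. *)
Lemma runs_repeat_add (P : program) (b c j : nat) N M :
  installed P b (repeat (NAdd 3 3 j) c) -> j <> 3%nat ->
  exists N', runs P (Config b N M) c (Config (b + c) N' M) /\
    N' 3%nat = (N 3 + N j * c)%nat /\ forall i, i <> 3%nat -> N' i = N i.
Proof.
  intros Hi Hj. revert b N Hi. induction c as [|c IH]; intros b N Hi.
  - exists N. rewrite Nat.add_0_r. split; [constructor|]. split; [lia|auto].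
  - simpl in Hi. apply installed_cons in Hi as (I0 & Hi).
    destruct (IH (S b) (upd N 3%nat (N 3 + N j)%nat) Hi) as (N' & E & E3 & Eo).
    exists N'. split; [|split].
    + replace (b + S c)%nat with (S b + c)%nat by lia.
      econstructor; [exact I0|]. exact E.
    + rewrite E3. regs. lia.
    + intros i Hne. rewrite Eo by auto. now regs.
Qed.

Ltac run_one := eapply runs_trans; [eapply runs_one; [eassumption|reflexivity]|];
  cbn [step nreg rreg pc Nat.eqb].

(** Invariant: cells 1 to j are still original, those above j are already copied, and K + m holds
    the old R[0]. Since K >= 1, each write lands above all cells still to be read. Six instructions
    per cell plus the final test give 6 j + 1. *)
Lemma runs_shift_loop (P : program) (b K m : nat) (M0 : nat -> R) :
  installed P b (NJz 5 (b + 6) :: RLoad 0 5 :: NAdd 7 5 2 :: RStore 7 0 :: NSub 5 5 6 ::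
                 Jmp b :: nil) -> (1 <= K)%nat ->
  forall j N M, (j < m)%nat -> N 5%nat = j -> N 6%nat = 1%nat -> N 2%nat = K ->
    (forall a, (1 <= a <= j)%nat -> M a = M0 a) ->
    (forall a, (j < a < m)%nat -> M (K + a)%nat = M0 a) -> M (K + m)%nat = M0 0%nat ->
    exists N' M', runs P (Config b N M) (6 * j + 1) (Config (b + 6) N' M') /\
      (forall i, (i < 5)%nat -> N' i = N i) /\
      (forall a, (0 < a < m)%nat -> M' (K + a)%nat = M0 a) /\ M' (K + m)%nat = M0 0%nat.
Proof.
  intros Hi HK.
  apply installed_cons in Hi as (I0 & Hi). apply installed_cons in Hi as (I1 & Hi).
  apply installed_cons in Hi as (I2 & Hi). apply installed_cons in Hi as (I3 & Hi).
  apply installed_cons in Hi as (I4 & Hi). apply installed_cons in Hi as (I5 & _).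
  induction j as [|j IH]; intros N M Hj H5 H6 H2 Hlo Hhi Htop.
  - exists N, M. split; [|split; [auto|split; auto]].
    eapply runs_one; [exact I0|]. simpl. now rewrite H5.
  - destruct (IH (upd (upd N 7%nat (S j + K)%nat) 5%nat j)
                 (upd (upd M 0%nat (M (S j))) (S j + K)%nat (M (S j))))
      as (N' & M' & E & EN & EM & ET); try (regs; auto; lia).
    + intros a Ha. regs. apply Hlo; lia.
    + intros a Ha. destruct (Nat.eq_dec a (S j)) as [->|Hne].
      * rewrite (Nat.add_comm K). regs. apply Hlo; lia.
      * regs. apply Hhi; lia.
    + exists N', M'. split; [|split; [|split]]; auto.
      * replace (6 * S j + 1)%nat with (1 + (1 + (1 + (1 + (1 + (1 + (6 * j + 1)))))))%nat by lia.
        eapply runs_trans; [eapply runs_one; [exact I0|]|].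
        { cbn. rewrite H5. reflexivity. }
        run_one. run_one. run_one. run_one. run_one.
        regs. rewrite H5, H6, H2. replace (S j - 1)%nat with j by lia. exact E.
      * intros i Hlt. rewrite EN by auto. now regs.
Qed.

Lemma runs_prologue (d K : nat) (I : inst) (P : program) :
  (1 <= K)%nat -> installed P 0 (prologue d K) ->
  exists t N M, runs P (start_config d I) t (Config (length (prologue d K)) N M) /\
    (t <= (2 * d + 20) * size_of d I ^ 1)%nat /\
    N 0%nat = nc I /\ N 1%nat = nv I /\ N 2%nat = K /\
    forall a, (a < mem_size d I)%nat -> M (K + a)%nat = input d I a.
Proof.
  intros HK Hi. set (m := mem_size d I).
  replace (length (prologue d K)) with (2 + d + d + 13)%nat
    by (unfold prologue; rewrite !length_app, !repeat_length; simpl; lia).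
  unfold prologue in Hi.
  apply installed_app in Hi as (Ha & Hi). apply installed_app in Hi as (Hb & Hi).
  apply installed_app in Hi as (Hc & Hi). rewrite !repeat_length in *. simpl length in *.
  apply installed_cons in Ha as (I0 & Ha). apply installed_cons in Ha as (I1 & _).
  apply installed_cons in Hi as (J0 & Hi). apply installed_cons in Hi as (J1 & Hi).
  apply installed_cons in Hi as (J2 & Hi). apply installed_cons in Hi as (J3 & Hi).
  apply installed_cons in Hi as (J4 & Hi).
  change (installed P (S (S (S (S (S (0 + 2 + d + d))))))
    ((NJz 5 (2 + d + d + 11) :: RLoad 0 5 :: NAdd 7 5 2 :: RStore 7 0 :: NSub 5 5 6 ::
      Jmp (2 + d + d + 5) :: nil) ++ RLoad 0 4 :: RStore 2 0 :: nil)) in Hi.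
  apply installed_app in Hi as (Hl & Hi).
  apply installed_cons in Hi as (L0 & Hi). apply installed_cons in Hi as (L1 & _).
  simpl length in *.
  set (b := S (S (S (S (S (0 + 2 + d + d)))))) in *.
  replace (2 + d + d + 11)%nat with (b + 6)%nat in Hl by (unfold b; lia).
  replace (2 + d + d + 5)%nat with b in Hl by (unfold b; lia).
  replace (2 + d + d + 13)%nat with (S (S (b + 6))) by (unfold b; lia).
  set (N0 := nreg (start_config d I)). set (M0 := input d I).
  set (N1 := upd (upd N0 3%nat 1%nat) 3%nat (1 + nc I)%nat).
  destruct (runs_repeat_add P 2 d 0 N1 M0 Hb) as (N2 & E2 & E23 & E2o); [lia|].
  destruct (runs_repeat_add P (2 + d) d 1 N2 M0 Hc) as (N3 & E3 & E33 & E3o); [lia|].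
  assert (F0 : N3 0%nat = nc I) by (rewrite E3o, E2o by lia; reflexivity).
  assert (F1 : N3 1%nat = nv I) by (rewrite E3o, E2o by lia; reflexivity).
  assert (F3 : N3 3%nat = m).
  { rewrite E33, E23, (E2o 1%nat) by lia. unfold N1. regs. unfold m, mem_size.
    change (N0 0%nat) with (nc I). change (N0 1%nat) with (nv I). reflexivity. }
  set (N4 := upd (upd (upd (upd N3 2%nat K) 4%nat (m + K)%nat) 6%nat 1%nat) 5%nat (m - 1)%nat).
  set (M4 := upd M0 (m + K)%nat (M0 0%nat)).
  assert (Hm : (1 <= m)%nat) by (unfold m, mem_size; lia).
  destruct (runs_shift_loop P b K m M0 Hl HK (m - 1)%nat N4 M4)
    as (N5 & M5 & E5 & EN & EM & ET); try (unfold N4; regs; auto; lia).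
  - intros a Ha'. unfold M4. regs. reflexivity.
  - unfold M4. rewrite (Nat.add_comm K). now regs.
  - exists (1 + (1 + (d + (d + (1 + (1 + (1 + (1 + (1 +
      ((6 * (m - 1) + 1) + (1 + (1 + 0))))))))))))%nat,
      N5, (upd (upd M5 0%nat (M5 (m + K)%nat)) K (M5 (m + K)%nat)).
    split; [|split; [|split; [|split; [|split]]]].
    + run_one. run_one.
      eapply runs_trans; [exact E2|]. eapply runs_trans; [exact E3|].
      run_one. run_one. run_one. run_one. run_one.
      regs. rewrite F3.
      eapply runs_trans; [exact E5|].
      run_one. run_one.
      rewrite !EN by lia. unfold N4. regs.
      constructor.
    + assert (m <= size_of d I)%nat by (unfold m, mem_size, size_of, input_size; lia).
      rewrite Nat.pow_1_r. pose proof (size_of_pos d I). nia.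
    + rewrite EN by lia. unfold N4. now regs.
    + rewrite EN by lia. unfold N4. now regs.
    + rewrite EN by lia. unfold N4. now regs.
    + intros a Ha'. destruct (Nat.eq_dec a 0) as [->|Hne].
      * rewrite Nat.add_0_r. regs. rewrite (Nat.add_comm m). exact ET.
      * regs. apply EM. fold m in Ha'. lia.
Qed.

(** * Assembling the decision program *)

Definition instances (d : nat) : ctx :=
  Ctx inst (fun I => I) 0 (fun _ _ => O) (valid d).

Lemma decide_positive_dim (d : nat) : (0 < d)%nat ->
  exists (P : program) (a k : nat), forall I : inst, valid d I ->
    exists s, exec P (a * size_of d I ^ k) (start_config d I) = Some s /\
      (nreg s 0%nat = 1%nat <-> winnable d I).
Proof.
  intros Hd.
  destruct (Ncomp_solve d (instances d) Hd) with (loc := fun _ : nat => O) (h := 3%nat)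
    (r := 0%nat) as (code & len & K & a & k & Hlen & H).
  - intros I (Hn & _). exact Hn.
  - split; [lia|]. simpl; intros; lia.
  (* The successor leaves enough scratch room and also meets the requirement K >= 1 of the shift
     loop. *)
  - set (K' := S K). set (b := length (prologue d K')).
    (* The count in N[3] becomes the answer 1 - (1 - count), by truncated subtraction. *)
    set (fin := NSet 4 1 :: NSub 3 4 3 :: NSub 0 4 3 :: nil).
    exists (prologue d K' ++ code b ++ fin), (2 * d + 20 + (a + 3))%nat, (1 + k)%nat.
    intros I Hv. set (P := prologue d K' ++ code b ++ fin).
    assert (HP : installed P 0 P) by (intros i ins Hi; exact Hi).
    apply installed_app in HP as (Hp & HP). apply installed_app in HP as (Hc & HP).
    rewrite Hlen in HP. fold b in Hc, HP. simpl in Hc, HP.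
    destruct (runs_prologue d K' I P) as (t1 & N1 & M1 & E1 & T1 & R0 & R1 & R2 & Ri);
      [unfold K'; lia|auto|].
    fold b in E1.
    destruct (H I P b N1 M1 Hv Hc) as (t2 & N2 & M2 & E2 & T2 & (F1 & _) & Res).
    + rewrite R2. unfold K'; lia.
    + repeat split; auto.
      * simpl; intros; lia.
      * intros x Hx. rewrite R2. apply Ri. exact Hx.
    + exact Logic.I.
    + apply installed_cons in HP as (L0 & HP). apply installed_cons in HP as (L1 & HP).
      apply installed_cons in HP as (L2 & _).
      simpl in Res, T2.
      eexists. split.
      * apply (exec_runs P _ _ (t1 + (t2 + (1 + (1 + (1 + 0)))))).
        -- eapply runs_trans; [exact E1|]. eapply runs_trans; [exact E2|].
           run_one. run_one. run_one. constructor.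
        -- cbn [pc]. apply nth_error_None. unfold P. rewrite !length_app, Hlen.
           fold b. simpl. lia.
        -- eapply Nat.le_trans; [|apply poly_add, size_of_pos].
           pose proof (pow_pos (size_of d I) k (size_of_pos d I)). lia.
      * cbn [nreg]. regs. rewrite Res, <- (solve_correct d I Hd Hv). lia.
Qed.

(* In dimension 0 all distances vanish, so a valid instance has no voters or
   only the target; moreover the number of voters does not count for the
   input size. *)
Lemma decide_dim0 :
  exists (P : program) (a k : nat), forall I : inst, valid 0 I ->
    exists s, exec P (a * size_of 0 I ^ k) (start_config 0 I) = Some s /\
      (nreg s 0%nat = 1%nat <-> winnable 0 I).
Proof.
  (* The output is 1 - (1 - (n - 1)) with truncated subtraction, so it is 1 exactly when a rival
     exists; then there are no voters and all totals are 0. *)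
  exists (NSet 3 1 :: NSub 4 0 3 :: NSub 4 3 4 :: NSub 0 3 4 :: nil), 4%nat, 0%nat.
  intros I (Hn & He & _ & Hties).
  eexists. split; [reflexivity|]. cbn -[Nat.sub]. split.
  - intros H. exists (fun _ => 0). split; [unfold dist; simpl; rewrite sqrt_0; lra|].
    exists 1%nat. split; [lia|].
    assert (E : nv I = 0%nat).
    { destruct (nv I) eqn:E; auto. exfalso.
      apply (Hties 0%nat 0%nat 1%nat); try lia. reflexivity. }
    rewrite E. unfold score_other, score_target; simpl. lra.
  - intros (x & _ & j & Hj & _). lia.
Qed.

(* For every fixed dimension d there is a real-RAM program deciding the
   destructive control problem (l2 norm, arbitrary scoring rule given as
   input) in time polynomial in the input size; the output is N[0] = 1
   for YES. *)
Theorem theorem8 :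
  forall d : nat,
  exists (P : program) (a k : nat),
  forall (n m : nat) (c v : nat -> nat -> R) (f : nat -> R) (eps : R),
    valid_instance d n m c v f eps ->
    exists s : config,
      exec P (a * input_size d n m ^ k) (init_config d n m c v f eps) = Some s /\
      (nreg s O = 1%nat <-> destructive_yes d n m c v f eps).
Proof.
  intros d.
  assert (H : exists (P : program) (a k : nat), forall I : inst, valid d I ->
    exists s, exec P (a * size_of d I ^ k) (start_config d I) = Some s /\
      (nreg s 0%nat = 1%nat <-> winnable d I)).
  { destruct (Nat.eq_dec d 0) as [->|Hd].
    - apply decide_dim0.
    - apply decide_positive_dim. lia. }
  destruct H as (P & a & k & H). exists P, a, k.
  intros n m c v f eps Hv. exact (H (Inst n m c v f eps) Hv).
Qed.
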